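(* Let $C$ be a small set of parameters and let $A\subseteq M^k$ be $C$-definable. There are $C$-definable sets $A_1, \ldots, A_n \subseteq A$ which cover $A$ such that each $A_i$ is, up to permutation of coordinates, the graph of a $C$-definable continuous $m$-correspondence $f: U_i \rightrightarrows M^{k-d}$, where $U_i\subseteq M^{d}$ is a $C$-definable open set and $0 \leq d \leq k$.
   Context: Setting. $T$ is a complete NIP theory in a multi-sorted language $L$ with a distinguished home sort, $\mathcal M$ is an $|L|^+$-saturated model of $T$, and $M$ is the home sort of $\mathcal M$. ''Definable'' means definable in $\mathcal M$, possibly with parameters; ''small'' means of cardinality at most $|L|$. A definable set $X$ has dp-rank greater than $n$ if for $0 \le i \le n$ there are formulas $\phi_i(x,y)$ and infinite sets $B_i\subseteq M$ such that for any $(b_0,\dots,b_n) \in B_0\times\cdots\times B_n$ there is $a \in X$ such that for all $0 \le i \le n$ and $y \in B_i$: $\mathcal M \models \phi_i(a,y)$ if and only if $y=b_i$. $\mathcal M$ is assumed dp-minimal: $M$ has dp-rank one. $M$ is equipped with a definable uniform structure $\mathcal B$: a collection of subsets of $M^2$ of the form $\mathcal B=\{\varphi(M^2,\bar c): \bar c \in D\}$ for some formula $\varphi(x,y,\bar z)$ and some definable set $D$, such that (i) $\bigcap \mathcal B$ is the diagonal of $M^2$; (ii) each $U\in\mathcal B$ is symmetric; (iii) for all $U,V \in \mathcal B$ there is $W \in \mathcal B$ with $W \subseteq U\cap V$; (iv) for all $U \in \mathcal B$ there is $V\in\mathcal B$ with $V \circ V \subseteq U$, where $U\circ V=\{(x,z):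 \exists y\in M\ (x,y)\in U,\ (y,z)\in V\}$. For $x\in M$ and $U\in\mathcal B$ put $U[x]=\{y:(x,y)\in U\}$; $M$ has the topology in which a set is open iff for each of its points $x$ it contains $U[x]$ for some $U\in\mathcal B$, and $M^k$ has the product topology. For $x,y\in M^k$ and $U\in\mathcal B$, write $(x,y)\in U$ if $(x_i,y_i)\in U$ for all $i$. It is assumed that $M$ has no isolated points and that every infinite definable subset of $M$ has nonempty interior. Correspondences. A correspondence $f:E\rightrightarrows F$ consists of definable sets $E,F$ and a definable set $\mathrm{Graph}(f)\subseteq E\times F$ such that for every $x\in E$ the set $f(x)=\{y\in F:(x,y)\in\mathrm{Graph}(f)\}$ is finite and nonempty; it is $C$-definable if $E,F,\mathrm{Graph}(f)$ are. It is an $m$-correspondence if $|f(x)|=m$ for all $x\in E$; in the claim, $m$ and $d$ may depend on $i$. For $U\in\mathcal B$ write $(f(x),f(x'))\in U$ if for every $y\in f(x)$ there is $y'\in f(x')$ with $(y,y')\in U$ and for every $y'\in f(x')$ there is $y\in f(x)$ with $(y,y')\in U$. $f$ is continuous at $x\in E$ if for every $W\in\mathcal B$ there is $U\in\mathcal B$ such that $(f(x),f(x'))\in W$ for all $x'\in E$ with $(x,x')\in U$; $f$ is continuous if it is continuous at every point of $E$. Convention: when $d=0$ the graph of $f:M^0\rightrightarrows M^k$ is identified with a finite subset of $M^k$, and when $d=k$ the graph of $f:U\rightrightarrows M^0$ is identified with $U$.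
   Formalization: The uniform structure is assumed definable over C (φ without parameters, D a C-definable set); if it may use parameters unrelated to C the claim fails, e.g. for the usual uniformity of a saturated real closed field transported by a transposition of two transcendental points. *)

(* Defs.v *)
(* MathComp, with the sets and cardinals of mathcomp-classical. *)
From mathcomp Require Import all_boot perm.
From mathcomp Require Import boolp classical_sets functions cardinality.

Set Implicit Arguments.
Unset Strict Implicit.
Unset Printing Implicit Defensive.

Local Open Scope classical_set_scope.
Local Open Scope card_scope.

(** ** Multi-sorted first-order logic *)

Record language := Language {
  sort : Type;
  home : sort;
  fsym : Type;
  farity : fsym -> nat;
  fdom : forall f : fsym, 'I_(farity f) -> sort;
  fcod : fsym -> sort;
  rsym : Type;
  rarity : rsym -> nat;
  rdom : forall r : rsym, 'I_(rarity r) -> sort }.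

(* |L| is the cardinality of this type. As usual |L| is infinite (it is the
   number of L-formulas), which is the role of the summand nat. *)
Definition symbols (L : language) : Type :=
  (nat + sort L + (fsym L + rsym L))%type.

Record structure (L : language) := Structure {
  carrier :> sort L -> Type;
  finterp : forall f : fsym L,
    (forall i, carrier (fdom (f := f) i)) -> carrier (fcod f);
  rinterp : forall r : rsym L,
    (forall i, carrier (rdom (r := r) i)) -> Prop }.

(* A context is a type of variables V with a sort for each variable. [sum_ctx]
   concatenates two contexts; [ext_ctx] adds the variable [None]. *)
Definition sum_ctx (S I J : Type) (s : I -> S) (t : J -> S) : I + J -> S :=
  fun v => match v with inl i => s i | inr j => t j end.

Definition ext_ctx (S V : Type) (vs : V -> S) (s : S) : option V -> S :=
  fun v => match v with Some x => vs x | None => s end.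

Inductive term (L : language) (V : Type) (vs : V -> sort L) : sort L -> Type :=
| TVar (x : V) : term vs (vs x)
| TApp (f : fsym L) : (forall i, term vs (fdom (f := f) i)) -> term vs (fcod f).

Inductive formula (L : language) (V : Type) (vs : V -> sort L) : Type :=
| FEq (s : sort L) : term vs s -> term vs s -> formula vs
| FRel (r : rsym L) : (forall i, term vs (rdom (r := r) i)) -> formula vs
| FNot : formula vs -> formula vs
| FAnd : formula vs -> formula vs -> formula vs
| FEx (s : sort L) : formula (ext_ctx vs s) -> formula vs.

Section Semantics.
Variables (L : language) (M : structure L).

Definition env (V : Type) (vs : V -> sort L) : Type := forall x : V, M (vs x).

Definition sum_env (I J : Type) (s : I -> sort L) (t : J -> sort L)
    (e : env s) (e' : env t) : env (sum_ctx s t) :=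
  fun v => match v with inl i => e i | inr j => e' j end.

Definition ext_env (V : Type) (vs : V -> sort L) (s : sort L)
    (a : M s) (e : env vs) : env (ext_ctx vs s) :=
  fun v => match v with Some x => e x | None => a end.

Fixpoint eval (V : Type) (vs : V -> sort L) (e : env vs) (s : sort L)
    (t : term vs s) : M s :=
  match t with
  | TVar x => e x
  | TApp f ts => finterp (f := f) (fun i => eval e (ts i))
  end.

Fixpoint sat (V : Type) (vs : V -> sort L) (phi : formula vs) :
    env vs -> Prop :=
  match phi with
  | FEq s t u => fun e => eval e t = eval e u
  | FRel r ts => fun e => rinterp (r := r) (fun i => eval e (ts i))
  | FNot p => fun e => ~ sat p e
  | FAnd p q => fun e => sat p e /\ sat q e
  | FEx s p => fun e => exists a : M s, sat p (ext_env a e)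
  end.

End Semantics.

(** ** Theories *)

Definition sentence (L : language) : Type := formula (@of_void (sort L)).

Definition holds (L : language) (M : structure L) (phi : sentence L) : Prop :=
  sat (M := M) phi (fun v => match v with end).

Definition models (L : language) (M : structure L) (T : set (sentence L)) :=
  forall phi, T phi -> holds M phi.

Definition entails (L : language) (T : set (sentence L)) (phi : sentence L) :=
  forall M : structure L, models M T -> holds M phi.

Definition complete_theory (L : language) (T : set (sentence L)) : Prop :=
  (exists M : structure L, models M T) /\
  (forall phi, entails T phi \/ entails T (FNot phi)).

(* phi(x; y), with x and y finite tuples of variables of arbitrary sorts, is
   NIP if in no model of T is an infinite set of x-tuples shattered by phi. *)
Definition NIP_formula (L : language) (T : set (sentence L)) (n m : nat)
    (xs : 'I_n -> sort L) (ys : 'I_m -> sort L)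
    (phi : formula (sum_ctx xs ys)) : Prop :=
  forall M : structure L, models M T ->
  ~ exists A : set (env M xs), infinite_set A /\
      forall S : set (env M xs), S `<=` A ->
      exists b : env M ys, forall a, A a -> (sat phi (sum_env a b) <-> S a).

Definition NIP_theory (L : language) (T : set (sentence L)) : Prop :=
  forall (n m : nat) (xs : 'I_n -> sort L) (ys : 'I_m -> sort L)
    (phi : formula (sum_ctx xs ys)), NIP_formula T phi.

(** ** Parameters, saturation, definability *)

Section Definability.
Variables (L : language) (M : structure L).

Definition elt : Type := {s : sort L & M s}.

Definition small (C : set elt) : Prop := C #<= [set: symbols L].

(* An L(C)-formula in a context vs is an L-formula with one extra variable for
   each element of C, which [param_env] interprets as that element. *)
Definition param_ctx (C : set elt) : {c | C c} -> sort L :=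
  fun c => projT1 (sval c).

Definition param_env (C : set elt) : env M (@param_ctx C) :=
  fun c => projT2 (sval c).

Definition formula_over (C : set elt) (V : Type) (vs : V -> sort L) : Type :=
  formula (sum_ctx vs (@param_ctx C)).

Definition sat_over (C : set elt) (V : Type) (vs : V -> sort L)
    (phi : formula_over C vs) (e : env M vs) : Prop :=
  sat phi (sum_env e (@param_env C)).

(* |L|^+-saturation: |A| < |L|^+ means |A| <= |L|. *)
Definition saturated : Prop :=
  forall (A : set elt), small A ->
  forall (n : nat) (xs : 'I_n -> sort L) (Sigma : set (formula_over A xs)),
  (forall Sigma0, finite_set Sigma0 -> Sigma0 `<=` Sigma ->
    exists a, forall phi, Sigma0 phi -> sat_over phi a) ->
  exists a, forall phi, Sigma phi -> sat_over phi a.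

Definition definable (C : set elt) (V : Type) (vs : V -> sort L)
    (X : set (env M vs)) : Prop :=
  exists phi : formula_over C vs, X = [set e | sat_over phi e].

(** ** Powers of the home sort *)

Definition home_ctx (V : Type) : V -> sort L := fun _ => home L.

(* M^k, convertible to [env M (home_ctx 'I_k)]. *)
Definition power (k : nat) : Type := 'I_k -> M (home L).

Definition definable_power (C : set elt) (k : nat) (X : set (power k)) : Prop :=
  definable C (vs := @home_ctx 'I_k) X.

Definition definable_home (C : set elt) (X : set (M (home L))) : Prop :=
  definable_power C [set a : power 1 | X (a ord0)].

Definition definable_prod (C : set elt) (d e : nat)
    (G : set (power d * power e)) : Prop :=
  definable C (vs := @home_ctx ('I_d + 'I_e))
    [set v | G (fun i => v (inl i), fun j => v (inr j))].

(** ** dp-rank *)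

(* X has dp-rank greater than n. The formulas have no parameters, and y ranges
   over single elements of the home sort. *)
Definition dprank_gt (k : nat) (X : set (power k)) (n : nat) : Prop :=
  exists (phi : 'I_n.+1 -> formula (ext_ctx (@home_ctx 'I_k) (home L)))
    (B : 'I_n.+1 -> set (M (home L))),
    (forall i, infinite_set (B i)) /\
    forall b : 'I_n.+1 -> M (home L), (forall i, B i (b i)) ->
    exists a : power k, X a /\
      forall i y, B i y ->
        (sat (phi i) (ext_env y (a : env M (@home_ctx 'I_k))) <-> y = b i).

Definition dp_minimal : Prop :=
  dprank_gt [set: power 1] 0 /\ ~ dprank_gt [set: power 1] 1.

(** ** Definable uniform structures *)

(* In phi(x, y, z), x is [None], y is [Some None] and z is [Some (Some _)]. The
   formula has no parameters and the set D of parameter tuples is C-definable: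
   openness and continuity are to be C-definable notions. (For a uniformity
   defined over other parameters, a C-definable set need not be open up to a
   finite C-definable set: transport the usual uniformity of a saturated real
   closed field by the transposition of c and c + 1, with c in (-1, 0)
   transcendental, and take the set of positive elements.) *)
Definition definable_family (C : set elt)
    (B : set (set (M (home L) * M (home L)))) : Prop :=
  exists (n : nat) (zs : 'I_n -> sort L)
    (phi : formula (ext_ctx (ext_ctx zs (home L)) (home L)))
    (D : set (env M zs)),
    definable C D /\
    B = [set U | exists2 c, D c &
           U = [set p | sat phi (ext_env p.1 (ext_env p.2 c))]].

Definition definable_uniformity (C : set elt)
    (B : set (set (M (home L) * M (home L)))) : Prop :=
  [/\ definable_family C B,
      \bigcap_(U in B) U = diagonal,
      forall U, B U -> forall x y, U (x, y) -> U (y, x),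
      forall U V, B U -> B V -> exists2 W, B W & W `<=` U `&` V
    & forall U, B U -> exists2 V, B V & (V \; V)%relation `<=` U].

Section Topology.
Variable B : set (set (M (home L) * M (home L))).

Definition open_home (O : set (M (home L))) : Prop :=
  forall x, O x -> exists2 U, B U & [set y | U (x, y)] `<=` O.

(* The product topology on M^k. *)
Definition open_power (k : nat) (O : set (power k)) : Prop :=
  forall x, O x -> exists V : 'I_k -> set (M (home L)),
    [/\ forall i, open_home (V i), forall i, V i (x i)
      & [set y | forall i, V i (y i)] `<=` O].

Definition no_isolated_points : Prop := forall x, ~ open_home [set x].

Definition infinite_definable_has_interior : Prop :=
  forall X, definable_home setT X -> infinite_set X ->
  exists O, [/\ open_home O, O !=set0 & O `<=` X].

(** ** Correspondences *)

(* (x, y) \in U for x, y in M^k. *)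
Definition near_power (U : set (M (home L) * M (home L))) (k : nat)
    (x y : power k) : Prop := forall i, U (x i, y i).

Definition near_sets (U : set (M (home L) * M (home L))) (k : nat)
    (X Y : set (power k)) : Prop :=
  (forall y, X y -> exists2 y', Y y' & near_power U y y') /\
  (forall y', Y y' -> exists2 y, X y & near_power U y y').

Definition fiber (d e : nat) (G : set (power d * power e)) (x : power d) :
  set (power e) := [set y | G (x, y)].

(* G is the graph of a C-definable correspondence E => F. *)
Definition correspondence (C : set elt) (d e : nat)
    (E : set (power d)) (F : set (power e)) (G : set (power d * power e)) :=
  [/\ definable_power C E, definable_power C F, definable_prod C G,
      G `<=` E `*` F
    & forall x, E x -> finite_set (fiber G x) /\ fiber G x !=set0].

Definition valued_in_size (m d e : nat) (E : set (power d))
    (G : set (power d * power e)) : Prop :=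
  forall x, E x -> fiber G x #= `I_m.

Definition continuous_at (d e : nat) (E : set (power d))
    (G : set (power d * power e)) (x : power d) : Prop :=
  forall W, B W -> exists2 U, B U &
    forall x', E x' -> near_power U x x' -> near_sets W (fiber G x) (fiber G x').

Definition continuous_corr (d e : nat) (E : set (power d))
    (G : set (power d * power e)) : Prop :=
  forall x, E x -> continuous_at E G x.

End Topology.

(* The identification of M^k with M^d x M^(k-d), for d <= k. *)
Definition split_power (k d : nat) (hd : d <= k) (a : power k) :
    power d * power (k - d) :=
  (fun i => a (cast_ord (subnKC hd) (lshift (k - d) i)),
   fun j => a (cast_ord (subnKC hd) (rshift d j))).

Definition graph_up_to_perm (k d : nat) (hd : d <= k) (s : 'S_k)
    (G : set (power d * power (k - d))) : set (power k) :=
  [set a | G (split_power hd (fun i => a (s i)))].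

(* X is, up to permutation of coordinates, the graph of a C-definable continuous
   m-correspondence U => M^(k-d) with U a C-definable open subset of M^d. *)
Definition continuous_graph (B : set (set (M (home L) * M (home L))))
    (C : set elt) (k : nat) (X : set (power k)) : Prop :=
  exists (d : nat) (hd : d <= k) (m : nat) (s : 'S_k)
    (U : set (power d)) (G : set (power d * power (k - d))),
    [/\ open_power B U,
        correspondence C U [set: power (k - d)] G,
        valued_in_size m U G,
        continuous_corr B U G
      & X = graph_up_to_perm hd s G].

End Definability.

(* Main.v *)
From mathcomp Require Import all_boot perm.
From mathcomp Require Import boolp classical_sets functions cardinality.
Require Import Defs.

(** Call a definable subset of [M^d] large if it has nonempty interior. The core
    is a Baire property: if a definable family [Y_c] increases as the entourage
    [c] shrinks and its union is large, then some [Y_c] is large. Write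
    [M^(d+1) = M * M^d] and suppose that no [Y_c] is large. Given finitely many
    boxes of [M^d], for all but finitely many [x] the complements of all fibers
    [(Y_c)_x] are large in each box, while by induction the fiber itself is large
    in each box as soon as [c] is small. Iterating, one obtains a binary tree of
    boxes on which the pairs [(x, c)] are shattered, against NIP.

    It follows that a tuple none of whose coordinates is algebraic over [C] and
    the other ones is generic: it is interior to every [C]-definable set that
    contains it. It also follows that a correspondence is continuous at generic
    points, since its set of discontinuity is the increasing union of the sets of
    [w]-discontinuity, none of which is large. For [a] in [A], choose a minimal
    set [I] of coordinates such that [a] is algebraic over [C] and [a_I]. Then
    [a_I] is generic, so [a] lies on a suitable graph contained in [A], and
    saturation extracts finitely many such graphs covering [A]. *)

Set Implicit Arguments.
Unset Strict Implicit.
Unset Printing Implicit Defensive.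

Local Open Scope classical_set_scope.
Local Open Scope card_scope.

(** * Substitution *)

Section Substitution.
Variables (L : language) (M : structure L).

Fixpoint tsubst (V : Type) (vs : V -> sort L) (W : Type) (ws : W -> sort L)
    (f : forall v, term ws (vs v)) (s : sort L) (t : term vs s) : term ws s :=
  match t with
  | TVar x => f x
  | TApp g ts => TApp (fun i => tsubst f (ts i))
  end.

Definition lift_subst (V : Type) (vs : V -> sort L) (W : Type)
    (ws : W -> sort L) (f : forall v, term ws (vs v)) (s : sort L) (v : option V) :
    term (ext_ctx ws s) (ext_ctx vs s v) :=
  match v with
  | Some x => tsubst (fun w : W => TVar (ext_ctx ws s) (Some w)) (f x)
  | None => TVar (ext_ctx ws s) None
  end.

Fixpoint fsubst (V : Type) (vs : V -> sort L) (phi : formula vs) :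
    forall (W : Type) (ws : W -> sort L), (forall v, term ws (vs v)) -> formula ws :=
  match phi with
  | FEq s t u => fun W ws f => FEq (tsubst f t) (tsubst f u)
  | FRel r ts => fun W ws f => FRel (fun i => tsubst f (ts i))
  | FNot p => fun W ws f => FNot (fsubst p f)
  | FAnd p q => fun W ws f => FAnd (fsubst p f) (fsubst q f)
  | FEx s p => fun W ws f => FEx (fsubst p (fun v => lift_subst f s v))
  end.

Lemma eval_tsubst (V : Type) (vs : V -> sort L) (W : Type) (ws : W -> sort L)
    (f : forall v, term ws (vs v)) (s : sort L) (t : term vs s) (e : env M ws) :
  eval e (tsubst f t) = eval (fun v => eval e (f v)) t.
Proof.
elim: t => //= g ts IH; congr (finterp _); apply: functional_extensionality_dep => i.
exact: IH.
Qed.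

Lemma sat_fsubst (V : Type) (vs : V -> sort L) (phi : formula vs) (W : Type)
    (ws : W -> sort L) (f : forall v, term ws (vs v)) (e : env M ws) :
  sat (fsubst phi f) e <-> sat phi (fun v => eval e (f v)).
Proof.
elim: phi W ws f e => {V vs}
  [V vs s t u|V vs r ts|V vs p IH|V vs p IHp q IHq|V vs s p IH] W ws f e /=.
- by rewrite !eval_tsubst.
- suff -> : (fun i => eval e (tsubst f (ts i))) =
            (fun i => eval (fun v => eval e (f v)) (ts i)) by [].
  by apply: functional_extensionality_dep => i; rewrite eval_tsubst.
- by rewrite IH.
- by rewrite IHp IHq.
- suff H a : sat (fsubst p (fun v => lift_subst f s v)) (ext_env a e) <->
      sat p (ext_env a (fun v => eval e (f v))).
    by split=> -[a /H]; exists a.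
  rewrite IH; suff -> : (fun v => eval (ext_env a e) (lift_subst f s v)) =
            ext_env a (fun v => eval e (f v)) by [].
  by apply: functional_extensionality_dep => -[x|] //=; rewrite eval_tsubst.
Qed.

(* Substitution in its existential form: which term replaces a variable may
   depend on an analysis of the variable that rewrites its sort. *)
Lemma subst_ex (V : Type) (vs : V -> sort L) (phi : formula vs) (W : Type)
    (ws : W -> sort L) (X : Type) (e : X -> env M vs) (e' : X -> env M ws) :
  (forall v, exists t : term ws (vs v), forall x, eval (e' x) t = e x v) ->
  exists psi : formula ws, forall x, sat psi (e' x) <-> sat phi (e x).
Proof.
move=> H; exists (fsubst phi (fun v => sval (cid (H v)))) => x.
rewrite sat_fsubst.
suff -> : (fun v => eval (e' x) (sval (cid (H v)))) = e x by [].
by apply: functional_extensionality_dep => v; case: cid => t /= ->.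
Qed.

(** As the sort depends on the index, each value is specified by transport along every equality of
    indices. Uniqueness of identity proofs on ordinals trivializes the transports, and choice
    assembles the environment. *)
Lemma ex_env_cons (n : nat) (ws : 'I_n.+1 -> sort L) (a : M (ws ord0))
    (w' : env M (fun j : 'I_n => ws (lift ord0 j))) :
  exists w : env M ws, w ord0 = a /\ forall j, w (lift ord0 j) = w' j.
Proof.
have H i : exists x : M (ws i), (forall h : ord0 = i, x = eq_rect _ (fun i => M (ws i)) a _ h) /\
    (forall j (h : lift ord0 j = i), x = eq_rect _ (fun i => M (ws i)) (w' j) _ h).
  case: (unliftP ord0 i) => [j|] ->.
    exists (w' j); split=> [h|k h]; first by exfalso; have := neq_lift ord0 j; rewrite -h eqxx.
    by have hk := lift_inj h; subst k; rewrite (eq_axiomK h).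
  exists a; split=> [h|k h]; first by rewrite (eq_axiomK h).
  by exfalso; have := neq_lift ord0 k; rewrite h eqxx.
exists (fun i => sval (cid (H i))); split=> [|j].
- by case: cid => x [h _] /=; exact: (h erefl).
- by case: cid => x [_ h] /=; exact: (h j erefl).
Qed.

(** [FEx] binds one variable. Moving the head of the tuple into the context leaves a shorter tuple
    for the induction. *)
Lemma ex_elim_ord (n : nat) (ws : 'I_n -> sort L) (V : Type) (vs : V -> sort L)
    (phi : formula (sum_ctx vs ws)) :
  exists psi : formula vs, forall e : env M vs,
    sat psi e <-> exists w : env M ws, sat phi (sum_env e w).
Proof.
elim: n ws V vs phi => [|n IH] ws V vs phi.
  have [|psi Hpsi] := @subst_ex _ _ phi V vs (env M vs * env M ws)
    (fun x => sum_env x.1 x.2) (fun x => x.1).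
    by case=> [v|[]//]; exists (TVar vs v).
  have w0 : env M ws by case.
  exists psi => e; rewrite (Hpsi (e, w0)) /=; split=> [h|[w h]]; first by exists w0.
  suff -> : w0 = w by [].
  by apply: functional_extensionality_dep => -[].
pose ws' (j : 'I_n) := ws (lift ord0 j).
have [|phi' Hphi'] := @subst_ex _ _ phi _ (sum_ctx (ext_ctx vs (ws ord0)) ws')
    (env M vs * env M ws) (fun x => sum_env x.1 x.2)
    (fun x => sum_env (ext_env (x.2 ord0) x.1) (fun j => x.2 (lift ord0 j))).
  case=> [v|i].
    by exists (TVar (sum_ctx (ext_ctx vs (ws ord0)) ws') (inl (Some v))).
  rewrite /=; case: (unliftP ord0 i) => [j|] ->.
    by exists (TVar (sum_ctx (ext_ctx vs (ws ord0)) ws') (inr j)).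
  by exists (TVar (sum_ctx (ext_ctx vs (ws ord0)) ws') (inl None)).
have [psi Hpsi] := IH _ _ _ phi'.
exists (FEx psi) => e /=; split=> [[a /Hpsi[w' hw']]|[w hw]].
  have [w [wa wl]] := ex_env_cons a w'; exists w.
  apply/(Hphi' (e, w)); rewrite /= wa.
  suff -> : (fun j => w (lift ord0 j)) = w' by [].
  by apply: functional_extensionality_dep.
by exists (w ord0); apply/Hpsi; exists (fun j => w (lift ord0 j)); apply/(Hphi' (e, w)).
Qed.

Lemma env_enum_surj (I : finType) (ws : I -> sort L)
    (w' : env M (fun j : 'I_#|I| => ws (enum_val j))) :
  exists w : env M ws, forall j, w (enum_val j) = w' j.
Proof.
have H i : exists x : M (ws i),
    forall j (h : enum_val j = i), x = eq_rect _ (fun i => M (ws i)) (w' j) _ h.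
  rewrite -(enum_rankK i); exists (w' (enum_rank i)) => j h.
  by have hk := enum_val_inj h; subst j; rewrite (eq_axiomK h).
exists (fun i => sval (cid (H i))) => j.
by case: cid => x h /=; exact: (h j erefl).
Qed.

Lemma ex_elim (I : finType) (ws : I -> sort L) (V : Type) (vs : V -> sort L)
    (phi : formula (sum_ctx vs ws)) :
  exists psi : formula vs, forall e : env M vs,
    sat psi e <-> exists w : env M ws, sat phi (sum_env e w).
Proof.
pose ws' (j : 'I_#|I|) := ws (enum_val j).
have [|phi' Hphi'] := @subst_ex _ _ phi _ (sum_ctx vs ws')
    (env M vs * env M ws) (fun x => sum_env x.1 x.2)
    (fun x => sum_env x.1 (fun j => x.2 (enum_val j))).
  case=> [v|i]; first by exists (TVar (sum_ctx vs ws') (inl v)).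
  rewrite /= -(enum_rankK i).
  by exists (TVar (sum_ctx vs ws') (inr (enum_rank i))).
have [psi Hpsi] := ex_elim_ord phi'.
exists psi => e; rewrite Hpsi; split=> [[w' hw']|[w hw]].
  have [w hw] := env_enum_surj w'; exists w; apply/(Hphi' (e, w)) => /=.
  suff -> : (fun j => w (enum_val j)) = w' by [].
  by apply: functional_extensionality_dep.
by exists (fun j => w (enum_val j)); apply/(Hphi' (e, w)).
Qed.

Lemma term_finite_vars (V : Type) (vs : V -> sort L) (s : sort L) (t : term vs s) :
  exists (I : finType) (p : I -> V) (t' : term (fun i => vs (p i)) s),
    forall e : env M vs, eval (fun i => e (p i)) t' = eval e t.
Proof.
elim: t => [x|f ts IH].
  by exists unit, (fun=> x), (TVar (fun _ : unit => vs x) tt).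
pose I i := sval (cid (IH i)).
pose p i : I i -> V := sval (cid (svalP (cid (IH i)))).
have Ht i : exists t' : term (fun j => vs (p i j)) (fdom (f := f) i),
    forall e : env M vs, eval (fun j => e (p i j)) t' = eval e (ts i).
  exact: (svalP (cid (svalP (cid (IH i))))).
pose q (x : {i & I i}) := p (tag x) (tagged x).
exists {i & I i}, q, (TApp (fun i =>
  tsubst (fun j : I i => TVar (fun x => vs (q x)) (Tagged I j)) (sval (cid (Ht i))))).
move=> e /=; congr finterp; apply: functional_extensionality_dep => i.
by rewrite eval_tsubst /=; case: cid => t' /= <-.
Qed.

(** Contexts may be infinite, as that of all parameters may be. This cuts a formula down to finitely
    many parameters later on. *)
Lemma formula_finite_vars (V : Type) (vs : V -> sort L) (phi : formula vs) :
  exists (I : finType) (p : I -> V) (psi : formula (fun i => vs (p i))),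
    forall e : env M vs, sat psi (fun i => e (p i)) <-> sat phi e.
Proof.
have sumS V1 (vs1 : V1 -> sort L) (I J : finType) (p : I -> V1) (q : J -> V1) :
  let r (x : I + J) := match x with inl i => p i | inr j => q j end in
  (forall i, exists t : term (fun x => vs1 (r x)) (vs1 (p i)),
     forall e : env M vs1, eval (fun x => e (r x)) t = e (p i)) /\
  (forall j, exists t : term (fun x => vs1 (r x)) (vs1 (q j)),
     forall e : env M vs1, eval (fun x => e (r x)) t = e (q j)).
  move=> r; split=> i.
    by exists (TVar (fun x => vs1 (r x)) (inl i)).
  by exists (TVar (fun x => vs1 (r x)) (inr i)).
elim: phi => {V vs} [V vs s t u|V vs r ts|V vs f IH|V vs f IHf g IHg|V vs s f IH].
- have [I [p [t' ht]]] := term_finite_vars t.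
  have [J [q [u' hu]]] := term_finite_vars u.
  have [hI hJ] := sumS _ vs _ _ p q.
  exists (I + J)%type; eexists.
  exists (FEq (tsubst (fun i => sval (cid (hI i))) t')
              (tsubst (fun j => sval (cid (hJ j))) u')) => e /=.
  rewrite !eval_tsubst -ht -hu.
  have -> : (fun v => eval (fun i => e _) (sval (cid (hI v)))) = fun i => e (p i).
    by apply: functional_extensionality_dep => i; case: cid.
  have -> // : (fun v => eval (fun i => e _) (sval (cid (hJ v)))) = fun i => e (q i).
    by apply: functional_extensionality_dep => i; case: cid.
- have IH i := term_finite_vars (ts i).
  pose I i := sval (cid (IH i)).
  pose p i : I i -> V := sval (cid (svalP (cid (IH i)))).
  have Ht i : exists t' : term (fun j => vs (p i j)) (rdom (r := r) i),
      forall e : env M vs, eval (fun j => e (p i j)) t' = eval e (ts i).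
    exact: (svalP (cid (svalP (cid (IH i))))).
  pose q (x : {i & I i}) := p (tag x) (tagged x).
  exists {i & I i}, q, (FRel (fun i =>
    tsubst (fun j : I i => TVar (fun x => vs (q x)) (Tagged I j)) (sval (cid (Ht i))))).
  move=> e /=.
  set a := (X in rinterp X); set b := (X in _ <-> rinterp X).
  suff -> : a = b by [].
  apply: functional_extensionality_dep => i.
  by rewrite /a /b eval_tsubst /=; case: cid => t' /= <-.
- by have [I [p [psi h]]] := IH; exists I, p, (FNot psi) => e /=; rewrite h.
- have [I [p [f' hf]]] := IHf; have [J [q [g' hg]]] := IHg.
  have [hI hJ] := sumS _ vs _ _ p q.
  exists (I + J)%type; eexists.
  exists (FAnd (fsubst f' (fun i => sval (cid (hI i))))
               (fsubst g' (fun j => sval (cid (hJ j))))) => e /=.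
  rewrite !sat_fsubst -hf -hg.
  have -> : (fun v => eval (fun i => e _) (sval (cid (hI v)))) = fun i => e (p i).
    by apply: functional_extensionality_dep => i; case: cid.
  have -> // : (fun v => eval (fun i => e _) (sval (cid (hJ v)))) = fun i => e (q i).
    by apply: functional_extensionality_dep => i; case: cid.
- have [I [p [psi h]]] := IH.
  (* The bound variable [None] is not free in the quantified formula, so only the indices that [p]
     sends to [Some] are kept. *)
  have hp' (j : {i : I | isSome (p i)}) : exists v, p (val j) = Some v.
    by case: j => i /=; case: (p i) => // v _; exists v.
  pose p' j := sval (cid (hp' j)).
  exists {i : I | isSome (p i)}, p'.
  have [|psi' hpsi'] := @subst_ex _ _ psi _ (ext_ctx (fun j => vs (p' j)) s)
     (env M vs * M s) (fun x i => ext_env x.2 x.1 (p i))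
     (fun x => ext_env x.2 (fun j => x.1 (p' j))).
    move=> i; case E: (p i) => [v|]; last first.
      by exists (TVar (ext_ctx (fun j => vs (p' j)) s) None).
    have hi : isSome (p i) by rewrite E.
    have hv : p' (exist _ i hi) = v.
      by rewrite /p'; case: cid => w /=; rewrite E => -[].
    rewrite -{}hv.
    by exists (TVar (ext_ctx (fun j => vs (p' j)) s) (Some (exist _ i hi))).
  exists (FEx psi') => e /=; split=> -[a Ha]; exists a.
    by apply/h/(hpsi' (e, a)).
  by apply/(hpsi' (e, a))/h.
Qed.

End Substitution.

(** * Definable predicates on spaces of finite tuples *)

Section Spaces.
Variables (L : language) (M : structure L).

(* A type of points given by finitely many coordinates of fixed sorts. *)
Structure space := Space {
  pt :> Type;
  svar : finType;
  ssort : svar -> sort L;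
  enc : pt -> env M ssort;
  enc_surj : forall e, exists p, enc p = e }.

Lemma env_surj (I : finType) (xs : I -> sort L) (e : env M xs) :
  exists p, id p = e.
Proof. by exists e. Qed.

Canonical env_space (I : finType) (xs : I -> sort L) := Space (@env_surj I xs).

Canonical power_space (d : nat) :=
  @Space (power M d) 'I_d (@home_ctx L 'I_d) id (@env_surj _ (@home_ctx L 'I_d)).

Lemma sort_surj (s : sort L) (e : env M (fun _ : unit => s)) :
  exists a, (fun _ : unit => a) = e.
Proof. by exists (e tt); apply: functional_extensionality_dep => -[]. Qed.

Canonical sort_space (s : sort L) := @Space (carrier M s) _ _ _ (@sort_surj s).

Lemma prod_surj (S T : space) (e : env M (sum_ctx (@ssort S) (@ssort T))) :
  exists p : S * T, sum_env (enc p.1) (enc p.2) = e.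
Proof.
have [p hp] := enc_surj (s := S) (fun v => e (inl v)).
have [q hq] := enc_surj (s := T) (fun v => e (inr v)).
by exists (p, q); rewrite /= hp hq; apply: functional_extensionality_dep => -[].
Qed.

Canonical prod_space (S T : space) :=
  @Space (pt S * pt T)%type _ _ _ (@prod_surj S T).

Definition dfn (C : set (elt M)) (S : space) (P : S -> Prop) : Prop :=
  exists phi : formula_over C (@ssort S), forall s, P s <-> sat_over phi (enc s).

(** Each coordinate of the value is given by a term, a stronger demand than a definable graph;
    preimages of definable sets are then obtained by substitution alone. *)
Definition dmap (C : set (elt M)) (S T : space) (f : S -> T) : Prop :=
  forall v : svar T, exists t : term (sum_ctx (@ssort S) (@param_ctx L M C)) (ssort v),
    forall s, eval (sum_env (enc s) (@param_env L M C)) t = enc (f s) v.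

Section Closure.
Variable C : set (elt M).
Implicit Types S T : space.

Lemma dmap_id S : dmap C (fun s : S => s).
Proof. by move=> v; exists (TVar (sum_ctx (@ssort S) (@param_ctx L M C)) (inl v)). Qed.

Lemma dmap_fst S T T' (f : S -> prod_space T T') :
  dmap C f -> dmap C (fun s => (f s).1).
Proof. by move=> hf v; exact: (hf (inl v)). Qed.

Lemma dmap_snd S T T' (f : S -> prod_space T T') :
  dmap C f -> dmap C (fun s => (f s).2).
Proof. by move=> hf v; exact: (hf (inr v)). Qed.

Lemma dmap_pair S T T' (f : S -> T) (g : S -> T') :
  dmap C f -> dmap C g -> dmap C (fun s => (f s, g s)).
Proof. by move=> hf hg; case=> v; [apply: hf|apply: hg]. Qed.

Lemma dmap_coord S d (f : S -> power M d) (i : 'I_d) :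
  dmap C f -> dmap C (fun s => f s i).
Proof. by move=> hf v; exact: (hf i). Qed.

Lemma dmap_tuple S d (f : S -> power M d) :
  (forall i, dmap C (fun s => f s i)) -> dmap C f.
Proof. by move=> hf i; exact: (hf i tt). Qed.

Lemma dmap_const S T (q : T) :
  (forall v, C (existT _ (ssort v) (enc q v))) -> dmap C (fun _ : S => q).
Proof.
move=> hq v.
by exists (TVar (sum_ctx (@ssort S) (@param_ctx L M C)) (inr (exist _ _ (hq v)))).
Qed.

Lemma dmap_comp S T T' (g : T -> T') (f : S -> T) :
  dmap C g -> dmap C f -> dmap C (fun s => g (f s)).
Proof.
move=> hg hf v; have [t ht] := hg v.
have h x : exists t' : term (sum_ctx (@ssort S) (@param_ctx L M C)) _,
    forall s, eval (sum_env (enc s) (@param_env L M C)) t' =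
      sum_env (enc (f s)) (@param_env L M C) x.
  by case: x => [y|c]; [exact: hf|exists (TVar (sum_ctx (@ssort S) (@param_ctx L M C)) (inr c))].
exists (tsubst (fun x => sval (cid (h x))) t) => s; rewrite eval_tsubst -ht.
suff -> : (fun x => eval (sum_env (enc s) (@param_env L M C)) (sval (cid (h x)))) =
  sum_env (enc (f s)) (@param_env L M C) by [].
by apply: functional_extensionality_dep => x; case: cid.
Qed.

Lemma dfn_comp S T (P : T -> Prop) (f : S -> T) :
  dfn C P -> dmap C f -> dfn C (fun s => P (f s)).
Proof.
move=> [phi hphi] hf.
have [|psi hpsi] := @subst_ex L M _ _ phi _ (sum_ctx (@ssort S) (@param_ctx L M C)) S
    (fun s => sum_env (enc (f s)) (@param_env L M C))
    (fun s => sum_env (enc s) (@param_env L M C)).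
  move=> [v|c]; first exact: hf.
  by exists (TVar (sum_ctx (@ssort S) (@param_ctx L M C)) (inr c)).
by exists psi => s; exact: iff_trans (hphi _) (iff_sym (hpsi s)).
Qed.

Lemma dfn_ext S (P Q : S -> Prop) : (forall s, P s <-> Q s) -> dfn C P -> dfn C Q.
Proof. by move=> PQ [phi h]; exists phi => s; rewrite -PQ. Qed.

Lemma dfn_not S (P : S -> Prop) : dfn C P -> dfn C (fun s => ~ P s).
Proof. by move=> [p hp]; exists (FNot p) => s; rewrite hp. Qed.

Lemma dfn_and S (P Q : S -> Prop) :
  dfn C P -> dfn C Q -> dfn C (fun s => P s /\ Q s).
Proof. by move=> [p hp] [q hq]; exists (FAnd p q) => s; rewrite hp hq. Qed.

Lemma dfn_or S (P Q : S -> Prop) :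
  dfn C P -> dfn C Q -> dfn C (fun s => P s \/ Q s).
Proof.
move=> hP hQ; apply: dfn_ext (dfn_not (dfn_and (dfn_not hP) (dfn_not hQ))) => s.
by rewrite not_andE !notK.
Qed.

Lemma dfn_imp S (P Q : S -> Prop) :
  dfn C P -> dfn C Q -> dfn C (fun s => P s -> Q s).
Proof.
move=> hP hQ; apply: dfn_ext (dfn_or (dfn_not hP) hQ) => s.
by rewrite implyE.
Qed.

Lemma dfn_True S : dfn C (fun _ : S => True).
Proof.
pose t := TVar (ext_ctx (sum_ctx (@ssort S) (@param_ctx L M C)) (home L)) None.
pose f := FEx (FEq t t).
by exists (FNot (FAnd f (FNot f))) => s; split=> // _ [].
Qed.

Lemma dfn_const S (P : Prop) : dfn C (fun _ : S => P).
Proof.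
have [p|np] := pselect P; first by apply: dfn_ext (dfn_True S).
by apply: dfn_ext (dfn_not (dfn_True S)) => s; split=> [/(_ I)|/np].
Qed.

Lemma dfn_ex S T (P : S -> T -> Prop) :
  dfn C (fun x : prod_space S T => P x.1 x.2) -> dfn C (fun s => exists t, P s t).
Proof.
move=> [phi hphi].
pose vs := sum_ctx (@ssort S) (@param_ctx L M C).
have [|phi' hphi'] := @subst_ex L M _ _ phi _ (sum_ctx vs (@ssort T))
    (S * env M (@ssort T))
    (fun x => sum_env (sum_env (enc x.1) x.2) (@param_env L M C))
    (fun x => sum_env (sum_env (enc x.1) (@param_env L M C)) x.2).
  case=> [[v|v]|c].
  - by exists (TVar (sum_ctx vs (@ssort T)) (inl (inl v))).
  - by exists (TVar (sum_ctx vs (@ssort T)) (inr v)).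
  - by exists (TVar (sum_ctx vs (@ssort T)) (inl (inr c))).
have [psi hpsi] := ex_elim M phi'.
exists psi => s; rewrite /sat_over hpsi; split=> [[t ht]|[w hw]].
  by exists (enc t); apply/(hphi' (s, enc t))/(hphi (s, t)).
have [t ht] := enc_surj w; subst w.
by exists t; apply/(hphi (s, t))/(hphi' (s, enc t)).
Qed.

Lemma dfn_all S T (P : S -> T -> Prop) :
  dfn C (fun x : prod_space S T => P x.1 x.2) -> dfn C (fun s => forall t, P s t).
Proof.
move=> /dfn_not hP; apply: dfn_ext (dfn_not (dfn_ex (P := fun s t => ~ P s t) hP)) => s.
split=> [h t|h [t nt]]; last by apply: nt; apply: h.
by have [//|nt] := pselect (P s t); case: h; exists t.
Qed.

Lemma dfn_ex2 S T (P Q : S -> T -> Prop) :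
  dfn C (fun x : prod_space S T => P x.1 x.2) ->
  dfn C (fun x : prod_space S T => Q x.1 x.2) ->
  dfn C (fun s => exists2 t, P s t & Q s t).
Proof.
move=> hP hQ.
apply: dfn_ext (dfn_ex (P := fun s t => P s t /\ Q s t) (dfn_and hP hQ)) => s.
by split=> [[t []]|[t]]; exists t.
Qed.

Lemma dfn_all_ord S n (P : S -> 'I_n -> Prop) :
  (forall i, dfn C (fun s => P s i)) -> dfn C (fun s => forall i, P s i).
Proof.
elim: n P => [|n IH] P hP; first by apply: dfn_ext (dfn_True S) => s; split=> // _ [].
apply: dfn_ext (dfn_and (hP ord0) (IH (fun s i => P s (lift ord0 i)) _)) => // s.
by split=> [[h0 h] i|h]; [case: (unliftP ord0 i) => [j|] ->|].
Qed.

Lemma dfn_eq S (s : sort L) (f g : S -> M s) :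
  dmap C f -> dmap C g -> dfn C (fun x => f x = g x).
Proof.
move=> /(_ tt)[t ht] /(_ tt)[t' ht'].
by exists (FEq t t') => x; rewrite /sat_over /= ht ht'.
Qed.

Lemma dfn_eq_power S d (f g : S -> power M d) :
  dmap C f -> dmap C g -> dfn C (fun x => f x = g x).
Proof.
move=> hf hg; apply: dfn_ext (dfn_all_ord (fun i => dfn_eq (dmap_coord i hf)
  (dmap_coord i hg))) => x; split=> [|-> //].
exact: functional_extensionality_dep.
Qed.

End Closure.

Lemma dfn_sub (C C' : set (elt M)) (S : space) (P : S -> Prop) :
  C `<=` C' -> dfn C P -> dfn C' P.
Proof.
move=> CC' [phi hphi].
have [|psi hpsi] := @subst_ex L M _ _ phi _ (sum_ctx (@ssort S) (@param_ctx L M C')) S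
    (fun s => sum_env (enc s) (@param_env L M C))
    (fun s => sum_env (enc s) (@param_env L M C')).
  case=> [v|[c hc]]; first by exists (TVar (sum_ctx (@ssort S) (@param_ctx L M C')) (inl v)).
  by exists (TVar (sum_ctx (@ssort S) (@param_ctx L M C')) (inr (exist _ c (CC' c hc)))).
by exists psi => s; exact: iff_trans (hphi _) (iff_sym (hpsi s)).
Qed.

Lemma dmap_constT (S T : space) (q : T) : dmap setT (fun _ : S => q).
Proof. exact: dmap_const. Qed.

(** The finitely many parameters of the formula become the tuple [q], and variables in their place
    make [Q] parameter-free. Saturation over small sets and NIP for formulas without parameters
    become applicable. *)
Lemma dfn_finite_params (S : space) (P : S -> Prop) : dfn setT P ->
  exists (I : finType) (ws : I -> sort L) (q : env M ws)
    (Q : prod_space S (env_space ws) -> Prop),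
    dfn set0 Q /\ forall s, P s <-> Q (s, q).
Proof.
move=> [phi hphi].
have [I [p [psi hpsi]]] := formula_finite_vars M phi.
pose isr (x : svar S + {c : elt M | setT c}) := if x is inr _ then true else false.
have hr (j : {i : I | isr (p i)}) : exists c, p (val j) = inr c.
  by case: j => i /=; case: (p i) => // c _; exists c.
pose r j := sval (cid (hr j)).
pose ws j : sort L := @param_ctx L M setT (r j).
pose q : env M ws := fun j => @param_env L M setT (r j).
pose vs := sum_ctx (sum_ctx (@ssort S) ws) (@param_ctx L M set0).
have [|chi hchi] := @subst_ex L M _ _ psi _ vs S
    (fun s i => sum_env (enc s) (@param_env L M setT) (p i))
    (fun s => sum_env (sum_env (enc s) q) (@param_env L M set0)).
  move=> i; case E: (p i) => [v|c].
    by exists (TVar vs (inl (inl v))).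
  have hi : isr (p i) by rewrite E.
  have hv : r (exist _ i hi) = c by rewrite /r; case: cid => w /=; rewrite E => -[].
  by rewrite -{}hv; exists (TVar vs (inl (inr (exist _ i hi)))).
exists {i : I | isr (p i)}, ws, q, (fun x => sat_over (C := set0) chi (enc x)).
split; first by exists chi.
move=> s; apply: iff_trans (hphi s) _.
exact: iff_trans (iff_sym (hpsi _)) (iff_sym (hchi s)).
Qed.

End Spaces.

#[global] Hint Resolve dmap_id dmap_fst dmap_snd dmap_pair dmap_constT : core.

(** * Consequences of saturation and NIP *)

Lemma finite_set_ord T (A : set T) : finite_set A ->
  exists n (g : 'I_n -> T), (forall i, A (g i)) /\ A `<=` range g.
Proof.
elim/Peq: T => T in A *.
move=> /finite_seqP[s ->].
exists (size s), (tnth (in_tuple s)); split=> [i|x /= xs]; first exact: mem_tnth.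
by have /tnthP[i ->] : x \in in_tuple s by []; exists i.
Qed.

Lemma nat_card_le (T : Type) (A : set T) (f : nat -> T) :
  injective f -> (forall n, A (f n)) -> [set: nat] #<= A.
Proof.
move=> finj fA; have := @inj_card_eq _ _ setT f (in2W finj).
rewrite card_eq_le => /andP[_ h]; apply: card_le_trans h _.
by apply: subset_card_le => _ [n _ <-].
Qed.

Lemma infinite_seq (T : Type) (A : set T) : infinite_set A ->
  exists f : nat -> T, injective f /\ forall n, A (f n).
Proof.
move=> /infiniteP/card_leP/unsquash f.
exists (fun n => val (f (SigSub (mem_set (I : setT n))))); split=> [m n|n].
  by move=> /val_inj/(inj (in_setT _) (in_setT _)) [].
exact: set_valP.
Qed.

Section Saturation.
Variables (L : language) (M : structure L).
Hypothesis hsat : saturated M.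

Lemma saturated_space (C : set (elt M)) (S : space M) (J : Type)
    (P : J -> S -> Prop) :
  small C -> (forall j, dfn C (P j)) ->
  (forall n (g : 'I_n -> J), exists s, forall i, P (g i) s) ->
  exists s, forall j, P j s.
Proof.
move=> hC hP hfin.
pose xs (j : 'I_#|svar S|) := ssort (enum_val j).
have H j : exists phi : formula_over C xs,
    forall s, sat_over phi (fun i => enc s (enum_val i)) <-> P j s.
  have [phi hphi] := hP j.
  have [|psi hpsi] := @subst_ex L M _ _ phi _ (sum_ctx xs (@param_ctx L M C)) S
     (fun s => sum_env (enc s) (@param_env L M C))
     (fun s => sum_env (fun i => enc s (enum_val i)) (@param_env L M C)).
    case=> [v|c]; last by exists (TVar (sum_ctx xs (@param_ctx L M C)) (inr c)).
    rewrite -(enum_rankK v).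
    by exists (TVar (sum_ctx xs (@param_ctx L M C)) (inl (enum_rank v))).
  by exists psi => s; exact: iff_trans (hpsi s) (iff_sym (hphi s)).
pose F j := sval (cid (H j)).
have hF j s : sat_over (F j) (fun i => enc s (enum_val i)) <-> P j s.
  by rewrite /F; case: cid => ? /= h; exact: h.
have [|a ha] := hsat hC (xs := xs) (Sigma := range F).
  move=> Sigma0 /finite_set_ord[n [g [hg gS]]] hS.
  have hj i : exists j, F j = g i by have [j _ <-] := hS _ (hg i); exists j.
  have [s hs] := hfin n (fun i => sval (cid (hj i))).
  exists (fun i => enc s (enum_val i)) => phi /gS[i _ <-].
  by have := hs i; case: cid => j /= <-; move/(hF j s).
have [e he] := env_enum_surj (ws := @ssort _ _ S) a.
have [s hs] := enc_surj e.
exists s => j; apply/hF; suff -> : (fun i => enc s (enum_val i)) = a by apply: ha; exists j.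
by apply: functional_extensionality_dep => i; rewrite hs.
Qed.

Lemma countable_small (C : set (elt M)) : countable C -> small C.
Proof.
move=> hC; apply: card_le_trans hC _.
apply: (@nat_card_le (symbols L) _ (fun n => inl (inl n))) => [m n [] //|n].
exact: I.
Qed.

(** Countably many formulas use countably many parameters, and a countable set is small because
    [symbols L] contains a copy of [nat]. *)
Lemma countable_saturation (S : space M) (P : nat -> S -> Prop) :
  (forall n, dfn setT (P n)) ->
  (forall n, exists s, forall i, (i < n)%N -> P i s) ->
  exists s, forall n, P n s.
Proof.
move=> hP hfin.
have H n := dfn_finite_params (hP n).
pose I n : finType := sval (cid (H n)).
pose ws n : I n -> sort L := sval (cid (svalP (cid (H n)))).
pose q n : env M (ws n) := sval (cid (svalP (cid (svalP (cid (H n)))))).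
have hq n : exists Q : prod_space S (env_space M (ws n)) -> Prop,
    dfn set0 Q /\ forall s, P n s <-> Q (s, q n).
  exact: (svalP (cid (svalP (cid (svalP (cid (H n))))))).
pose C : set (elt M) := \bigcup_(n in setT) range (fun i : I n => existT M (ws n i) (q n i)).
have hC : small C.
  apply: countable_small; apply: bigcup_countable => // n _.
  exact/finite_set_countable/finite_image.
apply: (@saturated_space C S nat P hC) => [n|n g].
  have [Q [hQ hPQ]] := hq n.
  apply: dfn_ext (fun s => iff_sym (hPQ s)) _.
  apply: (dfn_comp (T := prod_space S (env_space M (ws n))) (P := Q)).
    by apply: dfn_sub hQ.
  apply: dmap_pair; first exact: dmap_id.
  by apply: dmap_const => v; exists n => //; exists v.
have [s hs] := hfin (\max_i (g i)).+1.
by exists s => i; apply: hs; rewrite ltnS leq_bigmax.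
Qed.

(** By saturation an infinite pattern [f] is realized once its initial segments are, so the [s i]
    would be shattered. They are distinct, since the pattern true only at [i] separates [s i] from
    the others. *)
Lemma NIP_no_tree (T : set (sentence L)) (hNIP : NIP_theory T) (hMT : models M T)
    (S U : space M) (R : S -> U -> Prop) (s : nat -> S) :
  dfn setT (fun p : prod_space S U => R p.1 p.2) ->
  ~ (forall n (f : nat -> bool), exists t, forall i, (i < n)%N -> (R (s i) t <-> f i)).
Proof.
move=> hR hs.
have hs' (f : nat -> bool) : exists t, forall i, R (s i) t <-> f i.
  apply: (@countable_saturation U (fun i t => R (s i) t <-> f i)) => // i.
  have hRi : dfn setT (fun t => R (s i) t).
    by apply: (dfn_comp (f := fun t => (s i, t)) hR); apply: dmap_pair.
  case: (f i); [apply: dfn_ext hRi|apply: dfn_ext (dfn_not hRi)] => t.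
    by split=> [r|[_ h]]; [split|apply: h].
  by split=> [nr|[h _] /h //]; split=> // /nr.
(* NIP concerns formulas without parameters, so the parameters [q] of [R] are appended to the
   shattered tuples. *)
have [I [ws [q [Q [[phi hphi] hRQ]]]]] := dfn_finite_params hR.
pose sq := sum_ctx (@ssort L M S) ws.
pose xs (j : 'I_#|{: svar S + I}|) := sq (enum_val j).
pose ys (j : 'I_#|svar U|) := @ssort L M U (enum_val j).
have [|psi hpsi] := @subst_ex L M _ _ phi _ (sum_ctx xs ys) (S * U)
   (fun x => sum_env (sum_env (sum_env (enc x.1) (enc x.2)) q) (@param_env L M set0))
   (fun x => sum_env (fun i => sum_env (enc x.1) q (enum_val i))
                     (fun i => enc x.2 (enum_val i))).
  have hx (v : svar S + I) : exists t : term (sum_ctx xs ys) (sq v), forall x : S * U,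
     eval (sum_env (fun i => sum_env (enc x.1) q (enum_val i) : M (xs i))
                   (fun i => enc x.2 (enum_val i) : M (ys i))) t = sum_env (enc x.1) q v.
    rewrite -(enum_rankK v).
    by exists (TVar (sum_ctx xs ys) (inl (enum_rank v))).
  case=> [[[v|v]|v]|[? []]]; first exact: (hx (inl v)); last exact: (hx (inr v)).
  rewrite /= -(enum_rankK v).
  by exists (TVar (sum_ctx xs ys) (inr (enum_rank v))).
pose a i : env M xs := fun j => sum_env (enc (s i)) q (enum_val j).
have ha i t : sat psi (sum_env (a i) (fun j => enc t (enum_val j) : M (ys j))) <-> R (s i) t.
  apply: iff_trans (hpsi (s i, t)) _.
  exact: iff_trans (iff_sym (hphi (s i, t, q))) (iff_sym (hRQ (s i, t))).
apply: (hNIP _ _ _ _ psi M hMT).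
exists (range a); split.
  apply/infiniteP/(@nat_card_le _ _ a) => [i j aij|i]; last by exists i.
  apply: contrapT => nij; have [t ht] := hs' (fun k => k == i).
  have : R (s j) t by apply/ha; rewrite -aij; apply/ha/ht.
  by move/ht/eqP => eji; apply: nij.
move=> B BA; have [t ht] := hs' (fun i => `[< B (a i) >]).
exists (fun j => enc t (enum_val j)) => _ [i _ <-].
apply: iff_trans (ha i t) _; apply: iff_trans (ht i) _.
by split=> /asboolP.
Qed.

(* The index [t : seq bool] of a set of the tree lists the choices made so far,
   the latest one first. *)
Lemma NIP_no_splitting (T : set (sentence L)) (hNIP : NIP_theory T) (hMT : models M T)
    (S U : space M) (R : S -> U -> Prop) (F : set (set U)) (A0 : set U) :
  dfn setT (fun p : prod_space S U => R p.1 p.2) ->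
  F A0 -> (forall A, F A -> A !=set0) ->
  ~ (forall (I : finType) (A : I -> set U), (forall i, F (A i)) ->
      exists s, forall i (b : bool),
        exists A', [/\ F A', A' `<=` A i & forall x, A' x -> (R s x <-> b)]).
Proof.
move=> hR FA0 Fne split.
pose good (st : nat * (seq bool -> set U)) := forall t, size t = st.1 -> F (st.2 t).
have step (st : nat * (seq bool -> set U)) :
    exists sA : S * (seq bool -> set U), good st -> forall t b, size t = st.1 ->
      [/\ F (sA.2 (b :: t)), sA.2 (b :: t) `<=` st.2 t
        & forall x, sA.2 (b :: t) x -> (R sA.1 x <-> b)].
  have [gst|ngst] := pselect (good st); last first.
    (* Off the good states any value will do; [split] merely supplies a point of [S]. *)
    by have [s _] := split unit (fun=> A0) (fun=> FA0); exists (s, fun=> A0).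
  have [|s hs] := split _ (fun t : st.1.-tuple bool => st.2 t).
    by move=> t; apply: gst; rewrite size_tuple.
  have h (t : seq bool) : exists A', forall b t', t = b :: t' -> size t' = st.1 ->
      [/\ F A', A' `<=` st.2 t' & forall x, A' x -> (R s x <-> b)].
    case: t => [|b t]; first by exists A0.
    have [ht|nt] := pselect (size t = st.1); last by exists A0 => ? ? [_ <-].
    have [A' hA'] := hs (tcast ht (in_tuple t)) b.
    by exists A' => _ _ [<- <-] _; rewrite val_tcast in hA'.
  have [A' hA'] := choice h; exists (s, A') => _ t b ht /=.
  exact: (hA' (b :: t) b t).
have [next hnext] := choice step.
(* State [k] records the depth and the sets at that depth. At the root only the empty list is
   read. *)
pose st := fix st k := if k is j.+1 then (j.+1, (next (st j)).2) else (0%N, fun=> A0).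
have st1 k : (st k).1 = k by case: k.
have gst k : good (st k).
  elim: k => [|k IH] [|b t] //= [ht].
  by have [] := hnext (st k) IH t b; rewrite ?st1.
apply: (NIP_no_tree hNIP hMT (s := fun k => (next (st k)).1) hR) => k f.
pose path := fix path k := if k is j.+1 then f j :: path j else [::].
have spath j : size (path j) = j by elim: j => //= j ->.
have [|x hx] := Fne ((st k).2 (path k)); first by apply: gst; rewrite spath st1.
exists x; elim: k hx => [|k IH] //= hx i.
have [|_ sub hR'] := hnext (st k) (gst k) (path k) (f k); first by rewrite spath st1.
by rewrite ltnS leq_eqVlt => /predU1P[->|]; [exact: hR'|apply: IH; apply: sub].
Qed.

End Saturation.

(** * Definable relations and tuples of the home sort *)

Section DefinableRelations.
Variables (L : language) (M : structure L) (C : set (elt M)).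
Implicit Types S T : space M.

Definition dfn2 S T (R : S -> T -> Prop) : Prop :=
  dfn C (fun p : prod_space S T => R p.1 p.2).

Definition dfn3 S T T' (R : S -> T -> T' -> Prop) : Prop :=
  dfn C (fun p : prod_space S (prod_space T T') => R p.1 p.2.1 p.2.2).

Lemma dfn_app2 S T T' (R : T -> T' -> Prop) (f : S -> T) (g : S -> T') :
  dfn2 R -> dmap C f -> dmap C g -> dfn C (fun s => R (f s) (g s)).
Proof.
move=> hR hf hg.
by apply: (dfn_comp (f := fun s => (f s, g s)) hR); apply: dmap_pair.
Qed.

Lemma dfn_app3 S T T' T'' (R : T -> T' -> T'' -> Prop) (f : S -> T) (g : S -> T')
    (h : S -> T'') :
  dfn3 R -> dmap C f -> dmap C g -> dmap C h -> dfn C (fun s => R (f s) (g s) (h s)).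
Proof.
move=> hR hf hg hh.
by apply: (dfn_comp (f := fun s => (f s, (g s, h s))) hR); do 2 apply: dmap_pair => //.
Qed.

Definition pcons d (x : M (home L)) (y : power M d) : power M d.+1 :=
  fun i => oapp y x (unlift ord0 i).

Definition ptail d (v : power M d.+1) : power M d := fun i => v (lift ord0 i).

Lemma pcons0 d x (y : power M d) : pcons x y ord0 = x.
Proof. by rewrite /pcons unlift_none. Qed.

Lemma pconsS d x (y : power M d) i : pcons x y (lift ord0 i) = y i.
Proof. by rewrite /pcons liftK. Qed.

Lemma ptail_pcons d x (y : power M d) : ptail (pcons x y) = y.
Proof. by apply: functional_extensionality_dep => i; rewrite /ptail pconsS. Qed.

Lemma pconsE d (v : power M d.+1) : v = pcons (v ord0) (ptail v).
Proof.
apply: functional_extensionality_dep => i.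
by case: (unliftP ord0 i) => [j|] ->; rewrite ?pcons0 ?pconsS.
Qed.

Definition upd d (b : power M d) (i : 'I_d) (t : M (home L)) : power M d :=
  fun j => if j == i then t else b j.

Lemma upd_pcons0 d x (y : power M d) t : upd (pcons x y) ord0 t = pcons t y.
Proof.
apply: functional_extensionality_dep => i; rewrite /upd.
by case: (unliftP ord0 i) => [j|] ->; rewrite ?pcons0 ?pconsS.
Qed.

Lemma upd_pconsS d x (y : power M d) i t :
  upd (pcons x y) (lift ord0 i) t = pcons x (upd y i t).
Proof.
apply: functional_extensionality_dep => k; rewrite /upd.
by case: (unliftP ord0 k) => [j|] ->; rewrite ?pcons0 ?pconsS.
Qed.

Lemma dmap_pcons S d (f : S -> M (home L)) (g : S -> power M d) :
  dmap C f -> dmap C g -> dmap C (fun s => pcons (f s) (g s)).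
Proof.
move=> hf hg; apply: dmap_tuple => i; rewrite /pcons.
by case: (unlift ord0 i) => [j|] //=; apply: dmap_coord.
Qed.

Lemma dmap_ptail S d (f : S -> power M d.+1) :
  dmap C f -> dmap C (fun s => ptail (f s)).
Proof. by move=> hf; apply: dmap_tuple => i; apply: dmap_coord. Qed.

Lemma dmap_upd S d (f : S -> power M d) i (g : S -> M (home L)) :
  dmap C f -> dmap C g -> dmap C (fun s => upd (f s) i (g s)).
Proof.
move=> hf hg; apply: dmap_tuple => j; rewrite /upd.
by case: (j == i); [|apply: dmap_coord].
Qed.

End DefinableRelations.

(** * Automation of definability *)

Ltac dmap_step :=
  lazymatch goal with
  | H : dmap ?C ?f |- dmap ?C ?f => exact: H
  | |- dmap _ (fun _ => ?q) => exact: dmap_constT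
  | |- dmap _ (fun x => x) => exact: dmap_id
  | |- dmap _ fst => exact: (dmap_fst (@dmap_id _ _ _ _))
  | |- dmap _ snd => exact: (dmap_snd (@dmap_id _ _ _ _))
  | |- dmap _ (fun _ => (_, _)) => apply: dmap_pair
  | |- dmap _ (fun _ => pcons _ _) => apply: dmap_pcons
  | |- dmap _ (fun _ => ptail _) => apply: dmap_ptail
  | |- dmap _ (fun _ => upd _ _ _) => apply: dmap_upd
  | |- dmap _ (fun _ => (_).1) => apply: dmap_fst
  | |- dmap _ (fun _ => (_).2) => apply: dmap_snd
  (* What remains is a coordinate of a tuple; removing the last argument recovers the map into the
     power. *)
  | |- @dmap _ _ _ ?S _ (fun x => @?g x) =>
    let f := constr:(fun s : S =>
      ltac:(let t := eval cbv beta in (g s) in match t with ?h _ => exact h end)) in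
    refine (@dmap_coord _ _ _ _ _ f _ _)
  | |- @dmap _ _ ?C ?S ?T ?g => change (@dmap _ _ C S T (fun s => g s))
  end.

Ltac dmap_tac := repeat dmap_step.

Ltac dfn_atom :=
  try lazymatch goal with
  | |- dfn _ (fun _ => _) => idtac
  | |- @dfn _ _ ?C ?S ?P => change (@dfn _ _ C S (fun s => P s))
  end;
  multimatch goal with
  | H : dfn3 _ _ |- _ => apply: (dfn_app3 H)
  | H : dfn2 _ _ |- _ => apply: (dfn_app2 H)
  | H : dfn _ _ |- _ => apply: (dfn_comp H)
  end.

Ltac dfn_step :=
  lazymatch goal with
  | |- dfn _ (fun _ => ?P) => exact: dfn_const
  | |- dfn _ (fun _ => _ /\ _) => apply: dfn_and
  | |- dfn _ (fun _ => _ \/ _) => apply: dfn_or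
  | |- dfn _ (fun _ => ~ _) => apply: dfn_not
  | |- dfn _ (fun _ => exists2 _, _ & _) => apply: dfn_ex2
  | |- dfn _ (fun _ => exists _, _) => apply: dfn_ex
  | |- dfn _ (fun _ => _ = _) => first [apply: dfn_eq | apply: dfn_eq_power]
  (* Ordinals are not a sort of the structure, so a quantifier over them becomes a finite
     conjunction. *)
  | |- dfn _ (fun _ => forall _ : 'I__, _) => let i := fresh "i" in apply: dfn_all_ord => i
  | |- dfn _ (fun _ => _ -> _) => first [apply: dfn_imp | apply: dfn_all]
  | |- dfn _ (fun _ => forall _, _) => apply: dfn_all
  end.

Ltac dfn_tac :=
  rewrite ?/dfn2 ?/dfn3 /=;
  repeat first [ dmap_step | dfn_step | dfn_atom; solve [dmap_tac] ].

(** * Definability of finite cardinalities *)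

Section Counting.
Variables (L : language) (M : structure L) (C : set (elt M)).

(** A set has [n.+1] elements when removing some element leaves [n]. The removed element becomes a
    parameter, so the induction keeps [S] arbitrary. *)
Lemma dfn_card (S : space M) d n (R : S -> power M d -> Prop) :
  dfn2 C R -> dfn C (fun s => [set y | R s y] #= `I_n).
Proof.
elim: n S R => [|n IH] S R hR.
  have : dfn C (fun s => ~ exists y, R s y) by dfn_tac.
  apply: dfn_ext => s; rewrite II0 card_eq0; split=> [h|/eqP h [y hy]].
    by apply/eqP/seteqP; split=> // y hy; apply: h; exists y.
  by have : set0 y by rewrite -h.
have hR' : dfn2 C (fun (p : prod_space S (power_space M d)) y => R p.1 y /\ ~ y = p.2).
  by dfn_tac.
have : dfn C (fun s => exists y, R s y /\ [set z | R s z /\ ~ z = y] #= `I_n).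
  dfn_tac. exact: IH hR'.
apply: dfn_ext => s; split.
  by move=> [y [hy hc]]; apply/eq_cardSP; exists y.
by move=> /eq_cardSP[y hy hc]; exists y.
Qed.

End Counting.

(** * Large sets for a tame definable uniformity *)

Section Uniformity.
Variables (L : language) (T : set (sentence L)) (M : structure L).
Hypotheses (hsat : saturated M) (hNIP : NIP_theory T) (hMT : models M T).
Local Notation Mh := (M (home L)).

Variables (n : nat) (zs : 'I_n -> sort L) (D : set (env M zs))
  (u : env M zs -> Mh -> Mh -> Prop).

Definition near d (c : env M zs) (x y : power M d) : Prop :=
  forall i, u c (x i) (y i).

Definition interior1 (X : set Mh) (x : Mh) : Prop :=
  exists c, D c /\ forall y, u c x y -> X y.

Definition interior d (X : set (power M d)) (x : power M d) : Prop :=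
  exists c, D c /\ forall y, near c x y -> X y.

Definition large d (X : set (power M d)) : Prop := exists x, interior X x.

(** The uniformity is read on its indices [c] in [D]. Separation and the absence of isolated points
    enter in the form of [infinite_ball]. *)
Record tame_uniformity (C : set (elt M)) : Prop := TameUniformity {
  dfn_D : dfn C D;
  dfn_u : dfn3 C u;
  uniformity_ex : exists c, D c;
  u_refl : forall c x, D c -> u c x x;
  u_sym : forall c x y, D c -> u c x y -> u c y x;
  u_dir : forall c c', D c -> D c' ->
    exists2 c'', D c'' & forall x y, u c'' x y -> u c x y /\ u c' x y;
  u_half : forall c, D c ->
    exists2 c', D c' & forall x y z, u c' x y -> u c' y z -> u c x z;
  infinite_interior1 : forall X : set Mh, dfn setT X -> infinite_set X ->
    exists x, interior1 X x;
  infinite_ball : forall c x, D c -> infinite_set [set y | u c x y] }.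

Section Closure.
Variables (C : set (elt M)) (hu : tame_uniformity C).

Lemma dfn_near d : dfn3 C (@near d).
Proof. by have hu' := dfn_u hu; rewrite /near; dfn_tac. Qed.

Lemma dfn_interior (S : space M) d (X : S -> set (power M d)) :
  dfn2 C X -> dfn2 C (fun s => interior (X s)).
Proof.
move=> hX; have hD := dfn_D hu; have hn := @dfn_near d.
by rewrite /interior; dfn_tac.
Qed.

End Closure.
Hypothesis hu : tame_uniformity setT.

Lemma near_refl d c (x : power M d) : D c -> near c x x.
Proof. by move=> hc i; exact: (u_refl hu). Qed.

Lemma near_sym d c (x y : power M d) : D c -> near c x y -> near c y x.
Proof. by move=> hc h i; exact: (u_sym hu hc). Qed.

Lemma near_half c : D c -> exists2 c', D c' &
  (forall x y z, u c' x y -> u c' y z -> u c x z) /\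
  forall d (x y z : power M d), near c' x y -> near c' y z -> near c x z.
Proof.
move=> hc; have [c' hc' h] := u_half hu hc; exists c' => //; split=> // d x y z xy yz i.
exact: h (xy i) (yz i).
Qed.

Lemma near_pcons d c a b (y : power M d.+1) :
  near c (pcons a b) y <-> u c a (y ord0) /\ near c b (ptail y).
Proof.
split=> [h|[h0 h] i].
  by split=> [|i]; [rewrite -(pcons0 a b)|rewrite -(pconsS a b)]; apply: h.
by case: (unliftP ord0 i) => [j|] ->; rewrite ?pcons0 ?pconsS //; apply: h.
Qed.

Lemma u_dir_seq (I : eqType) (c : I -> env M zs) (s : seq I) :
  (forall i, D (c i)) ->
  exists2 c', D c' & forall i, i \in s -> forall x y, u c' x y -> u (c i) x y.
Proof.
move=> hc; elim: s => [|i s [c' hc' IH]].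
  by have [c' hc'] := uniformity_ex hu; exists c'.
have [c'' hc'' h] := u_dir hu hc' (hc i); exists c'' => // j.
by rewrite inE => /predU1P[->|/IH h'] x y /h[] // /h'.
Qed.

(** Finitely many entourages have a common refinement. As refinement is a definable condition on the
    index, saturation passes to countably many. *)
Lemma u_dir_countable (c : nat -> env M zs) : (forall i, D (c i)) ->
  exists2 c', D c' & forall i x y, u c' x y -> u (c i) x y.
Proof.
move=> hc; have hD := dfn_D hu; have hu' := dfn_u hu.
have [|k|c' hc'] := @countable_saturation L M hsat (env_space M zs)
   (fun i c' => D c' /\ forall x y, u c' x y -> u (c i) x y).
- by move=> i; dfn_tac.
- have [c' hc' h] := u_dir_seq (iota 0 k) hc; exists c' => i ik; split=> //.
  by apply: h; rewrite mem_iota.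
- by exists c' => [|i]; [case: (hc' 0%N)|case: (hc' i)].
Qed.

Lemma sub_large d (X Y : set (power M d)) : X `<=` Y -> large X -> large Y.
Proof. by move=> XY [x [c [hc h]]]; exists x, c; split=> // y /h/XY. Qed.

Lemma large_nonempty d (X : set (power M d)) : large X -> X !=set0.
Proof. by move=> [x [c [hc h]]]; exists x; apply/h/near_refl. Qed.

Lemma large_power0 (X : set (power M 0)) : X !=set0 -> large X.
Proof.
move=> [x Xx]; have [c hc] := uniformity_ex hu; exists x, c; split=> // y _.
by have -> : y = x by apply: functional_extensionality_dep => -[].
Qed.

(** * The Baire property *)

(** The set [X] beside the increasing family brings finite unions into the statement: for a constant
    [Y] it says that one of two definable sets covering a ball is large. *)
Definition directed_baire d : Prop :=
  forall (X : set (power M d)) (Y : env M zs -> set (power M d)),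
  dfn setT X -> dfn2 setT Y ->
  (forall c c', D c -> D c' -> (forall x y, u c' x y -> u c x y) -> Y c `<=` Y c') ->
  forall x0 c0, D c0 ->
  (forall y, near c0 x0 y -> X y \/ exists2 c, D c & Y c y) ->
  large X \/ exists2 c, D c & large (Y c).

Lemma large_setU d (hb : directed_baire d) (X X' : set (power M d)) x0 c0 :
  dfn setT X -> dfn setT X' -> D c0 ->
  (forall y, near c0 x0 y -> X y \/ X' y) -> large X \/ large X'.
Proof.
move=> hX hX' hc0 h.
have hX2 : dfn2 setT (fun _ : env M zs => X') by dfn_tac.
have [y /h[hy|hy]|hl|[c _ hl]] := hb X _ hX hX2 (fun _ _ _ _ _ _ h => h) x0 c0 hc0.
- by left.
- by right; exists c0.
- by left.
- by right.
Qed.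

Definition subball d (b b' : power M d * env M zs) : Prop :=
  forall z, near b.2 b.1 z -> near b'.2 b'.1 z.

Lemma large_subball d (X : set (power M d)) :
  large X -> exists2 b, D b.2 & forall z, near b.2 b.1 z -> X z.
Proof. by move=> [x [c [hc h]]]; exists (x, c). Qed.

(** Successive shrinking gives a ball suitable for finitely many points of [X], and saturation one
    suitable for infinitely many. The points for which this ball is suitable form an infinite
    definable set, which has interior. *)
Lemma uniform_ball d (K : Mh -> power M d -> power M d -> Prop) (X : set Mh) b0 :
  dfn3 setT K -> D b0.2 -> infinite_set X ->
  (forall x, X x -> forall b, D b.2 -> subball b b0 ->
    exists b', [/\ D b'.2, subball b' b &
      forall y z, near b'.2 b'.1 y -> near b'.2 b'.1 z -> K x y z]) ->
  exists b, [/\ D b.2, subball b b0 & exists x, interior1 [set x |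
    forall y z, near b.2 b.1 y -> near b.2 b.1 z -> K x y z] x].
Proof.
move=> hK hb0 /infinite_seq[f [finj fX]] dens.
have hD := dfn_D hu; have hn := dfn_near hu d.
pose P x (b : power M d * env M zs) :=
  forall y z, near b.2 b.1 y -> near b.2 b.1 z -> K x y z.
have hP : dfn2 setT P by rewrite /P; dfn_tac.
have [|k|b hb] := @countable_saturation L M hsat (prod_space (power_space M d) (env_space M zs))
   (fun i b => [/\ D b.2, subball b b0 & P (f i) b]).
- move=> i; suff : dfn setT (fun b : prod_space (power_space M d) (env_space M zs) =>
    D b.2 /\ (subball b b0 /\ P (f i) b)) by apply: dfn_ext => b; split=> [[? []]|[]].
  by rewrite /subball; dfn_tac.
- suff [b [hb sb Pb]] : exists b, [/\ D b.2, subball b b0 & forall i, (i < k)%N -> P (f i) b].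
    by exists b => i ik; split=> //; apply: Pb.
  elim: k => [|k [b [hb sb Pb]]]; first by exists b0; split.
  have [b' [hb' sb' Pb']] := dens _ (fX k) b hb sb.
  exists b'; split=> // [z /sb'/sb //|i].
  by rewrite ltnS leq_eqVlt => /predU1P[-> //|/Pb h] y z /sb' hy /sb'; apply: h.
exists b; case: (hb 0%N) => hbD sb _; split=> //.
apply: (infinite_interior1 hu) => [|fin]; first by dfn_tac.
apply: (infinite_nat); apply/finite_setPn => h; apply: (iffRL (infiniteP _)) fin.
by apply: (nat_card_le finj) => i; case: (hb i).
Qed.

Lemma large_pcons d (X : set (power M d.+1)) (b : power M d * env M zs) :
  D b.2 -> (exists x, interior1 [set x | forall y, near b.2 b.1 y -> X (pcons x y)] x) ->
  large X.
Proof.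
move=> hb [x [c [hc h]]]; have [c' hc' hcc] := u_dir hu hc hb.
exists (pcons x b.1), c'; split=> // v /near_pcons[xv bv].
rewrite (pconsE v); apply: h; first by case: (hcc _ _ xv).
by move=> i; case: (hcc _ _ (bv i)).
Qed.

(** At an exceptional [x] the fiber of [X] is large in every ball inside [b0], since its complement
    is not. With infinitely many such [x], [uniform_ball] would put a product of balls into [X]. *)
Lemma finite_thin_fibers d (hb : directed_baire d) (X : set (power M d.+1)) b0 :
  dfn setT X -> ~ large X -> D b0.2 ->
  finite_set [set x | ~ large [set y | near b0.2 b0.1 y /\ ~ X (pcons x y)]].
Proof.
move=> hX nX hb0; apply: contrapT => inf; apply: nX.
have hn := dfn_near hu d.
have hK : dfn3 setT (fun x (y z : power M d) => X (pcons x y)) by dfn_tac.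
have [|b [hbD _ hx]] := uniform_ball hK hb0 inf.
  move=> x nl b hbD sb.
  have hX1 : dfn setT [set y | near b.2 b.1 y /\ ~ X (pcons x y)] by rewrite /mkset; dfn_tac.
  have hX2 : dfn setT [set y | near b.2 b.1 y /\ X (pcons x y)] by rewrite /mkset; dfn_tac.
  have [y hy|l1|l2] := large_setU hb hX1 hX2 (x0 := b.1) hbD.
  - by have [|] := pselect (X (pcons x y)); [right|left].
  - by case: nl; apply: sub_large l1 => y [/sb].
  - have [b' hb' sb'] := large_subball l2.
    by exists b'; split=> // [z /sb'[]|y z /sb'[]].
apply: (large_pcons hbD); case: hx => x hx; exists x.
by case: hx => c [hc h]; exists c; split=> // y /h{}h z hz; apply: (h z z).
Qed.

Lemma u_dir_fin (I : finType) (c : I -> env M zs) : (forall i, D (c i)) ->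
  exists2 c', D c' & forall i x y, u c' x y -> u (c i) x y.
Proof.
move=> hc; have [c' hc' h] := u_dir_seq (enum I) hc; exists c' => // i.
by apply: h; rewrite mem_enum.
Qed.

(** An infinite union would contain an injective sequence, and the indices of its terms have a
    common refinement [c'] by saturation. Monotonicity puts the whole sequence into the finite union
    of the [F c' i]. *)
Lemma finite_bigcup_mono (I : finType) (F : env M zs -> I -> set Mh) :
  (forall c i, D c -> finite_set (F c i)) ->
  (forall c c' i, D c -> D c' -> (forall x y, u c' x y -> u c x y) -> F c i `<=` F c' i) ->
  finite_set [set x | exists2 c, D c & exists i, F c i x].
Proof.
move=> hfin hmono; apply: contrapT => /infinite_seq[f [finj hf]].
have [|c hc] := choice (P := fun k c => D c /\ exists i, F c i (f k)).
  by move=> k; have [c hc hi] := hf k; exists c.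
have [c' hc' hcc] := u_dir_countable (fun k => (hc k).1).
have : finite_set (\bigcup_(i in [set: I]) F c' i).
  by apply: bigcup_finite => // i _; apply: hfin.
apply/infiniteP/(nat_card_le finj) => k; have [hck [i hi]] := hc k.
by exists i => //; apply: hmono (hcc k) _ hi.
Qed.

Lemma directed_baire_all d : directed_baire d.
Proof.
elim: d => [|d IH] X Y hX hY hmono v0 c0 hc0 cov.
  case: (cov v0 (near_refl _ hc0)) => [h|[c hc h]].
    by left; apply: large_power0; exists v0.
  by right; exists c => //; apply: large_power0; exists v0.
apply: contrapT => /not_orP[nX nY].
have hn := dfn_near hu d; have hD := dfn_D hu; have hu' := dfn_u hu.
pose b0 := (ptail v0, c0).
(* The pairs [(x, c)] are to be shattered by tuples [y]; the tree consists of balls inside [b0]. *)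
pose S := prod_space (sort_space M (home L)) (env_space M zs).
pose R (s : S) (y : power M d) := Y s.2 (pcons s.1 y).
have hR : dfn2 setT R by rewrite /R; dfn_tac.
pose F (A : set (power M d)) := exists b, [/\ D b.2, subball b b0 &
  A = [set y | near b.2 b.1 y]].
apply: (NIP_no_splitting hsat hNIP hMT hR (F := F)); first by exists b0; split.
  by move=> _ [b [hb _ ->]]; exists b.1; apply: near_refl.
move=> I A hA.
have [b hb] := choice hA.
(* These are the exceptional [x], over which the complement of the fiber of [Z] is not large in the
   ball [b i]. *)
pose E Z i := [set x | ~ large [set y | near (b i).2 (b i).1 y /\ ~ Z (pcons x y)]].
have hE (Z : set (power M d.+1)) i : dfn setT Z -> ~ large Z -> finite_set (E Z i).
  by move=> hZ nZ; apply: finite_thin_fibers => //; case: (hb i).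
have hYc c : dfn setT (Y c) by dfn_tac.
have finX : finite_set (\bigcup_(i in [set: I]) E X i).
  by apply: bigcup_finite => // i _; apply: hE.
(* Finiteness for all [c] at once matters because [x] is chosen before the index [c'], which depends
   on it. *)
have finY : finite_set [set x | exists2 c, D c & exists i, E (Y c) i x].
  apply: (finite_bigcup_mono (F := fun c i => E (Y c) i)) => [c i hc|c c' i hc hc' hcc].
    by apply: hE => // l; apply: nY; exists c.
  move=> x nl l; apply: nl; apply: sub_large l => y [hy ny]; split=> // hy'.
  by apply: ny; apply: hmono hcc _ hy'.
have [x [vx]] : ([set x | u c0 (v0 ord0) x] `\` (\bigcup_(i in [set: I]) E X i `|`
    [set x | exists2 c, D c & exists i, E (Y c) i x])) !=set0.
  apply/infinite_setN0/infinite_setD; first exact: (infinite_ball hu).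
  by rewrite finite_setU.
move=> /not_orP[nEX nEY].
have lX i : large [set y | near (b i).2 (b i).1 y /\ ~ X (pcons x y)].
  by apply: contrapT => nl; apply: nEX; exists i.
have lY c i : D c -> large [set y | near (b i).2 (b i).1 y /\ ~ Y c (pcons x y)].
  by move=> hc; apply: contrapT => nl; apply: nEY; exists c => //; exists i.
(* In a ball inside [b i] that avoids the fiber of [X], the fibers of the [Y c] cover everything,
   and the induction hypothesis makes one of them large. *)
have [|c hc] := choice (P := fun i c => D c /\
    large [set y | near (b i).2 (b i).1 y /\ Y c (pcons x y)]).
  move=> i; have [b' hb' sb'] := large_subball (lX i).
  have hX' : dfn setT [set y | near b'.2 b'.1 y /\ X (pcons x y)] by rewrite /mkset; dfn_tac.
  have hY' : dfn2 setT (fun c => [set y | near b'.2 b'.1 y /\ Y c (pcons x y)]).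
    by rewrite /mkset; dfn_tac.
  have mono' c c' : D c -> D c' -> (forall x y, u c' x y -> u c x y) ->
      [set y | near b'.2 b'.1 y /\ Y c (pcons x y)] `<=`
      [set y | near b'.2 b'.1 y /\ Y c' (pcons x y)].
    by move=> hc hc' hcc y [hy hYy]; split=> //; apply: hmono hcc _ hYy.
  have [y hy|l|[c hc l]] := IH _ _ hX' hY' mono' b'.1 b'.2 hb'.
  - have [hbi sbi _] := hb i; have [hy' nXy] := sb' y hy.
    have [//|hXy|[c hc hYy]] := cov (pcons x y).
    + rewrite (pconsE v0); apply/near_pcons; rewrite pcons0; split=> // j.
      by rewrite /ptail pconsS; apply: sbi.
    + by left.
    + by right; exists c.
  - by have [y [/sb'[_ ny] /ny]] := large_nonempty l.
  - exists c; split=> //; apply: sub_large l => y [/sb'[]].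
    by [].
(* A common refinement keeps these fibers large by monotonicity, and their complements are large by
   the choice of [x]; so [(x, c')] splits every ball. *)
have [c' hc' hcc] := u_dir_fin (fun i => (hc i).1).
exists (x, c') => i [].
- have [_ l] := hc i; have [b' hb' sb'] := large_subball l.
  have [_ sbi ->] := hb i.
  exists [set y | near b'.2 b'.1 y]; split.
  + by exists b'; split=> // z /sb'[/sbi].
  + by move=> y /sb'[].
  + move=> y /sb'[_ hy]; split=> // _; have [hci _] := hc i.
    exact: hmono hci hc' (hcc i) _ hy.
- have [b' hb' sb'] := large_subball (lY c' i hc').
  have [_ sbi ->] := hb i.
  exists [set y | near b'.2 b'.1 y]; split.
  + by exists b'; split=> // z /sb'[/sbi].
  + by move=> y /sb'[].
  + by move=> y /sb'[_ ny]; split.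
Qed.

(** * Nearly constant correspondences *)

(* Convertible to [near_sets] for the entourage of [c]. *)
Definition near_fib e c (X Y : set (power M e)) : Prop :=
  (forall y, X y -> exists2 y', Y y' & near c y y') /\
  (forall y', Y y' -> exists2 y, X y & near c y y').

Lemma near_fib_refl e c (X : set (power M e)) : D c -> near_fib c X X.
Proof. by move=> hc; split=> y Xy; exists y => //; apply: near_refl. Qed.

Lemma near_fib_trans e c c' (X Y Z : set (power M e)) :
  (forall x y z : power M e, near c' x y -> near c' y z -> near c x z) ->
  near_fib c' X Y -> near_fib c' Y Z -> near_fib c X Z.
Proof.
move=> h [xy yx] [yz zy]; split=> [x /xy[y /yz[z hz yz'] xy']|z /zy[y /yx[x hx xy'] yz']].
  by exists z => //; apply: h yz'.
by exists x => //; apply: h yz'.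
Qed.

Lemma dfn_near_fib (S : space M) e (c : S -> env M zs) (X Y : S -> set (power M e)) :
  dmap setT c -> dfn2 setT X -> dfn2 setT Y ->
  dfn setT (fun s => near_fib (c s) (X s) (Y s)).
Proof.
move=> hc hX hY; have hn := dfn_near hu e; rewrite /near_fib; dfn_tac.
all: apply: (dfn_app3 hn); dmap_tac; exact: (dmap_comp hc (dmap_fst (dmap_fst (@dmap_id _ _ _ _)))).
Qed.

(** The coordinates of [v] are fixed one after the other. If the next coordinate takes finitely many
    values, one of them occurs for infinitely many [x]. Otherwise the values fill a ball; as fibers
    are finite, infinitely many [x] are needed to produce the values near its center. *)
Lemma infinite_near_point e (G : Mh -> set (power M e)) (X : set Mh) w :
  dfn2 setT G -> dfn setT X -> D w -> infinite_set X ->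
  (forall x, X x -> finite_set (G x) /\ G x !=set0) ->
  exists v, infinite_set [set x | X x /\ exists y, G x y /\ near w v y].
Proof.
move=> hG hX hw infX hGX.
suff main j : (j <= e)%N -> exists v, infinite_set [set x | X x /\ exists y, G x y /\
    forall i : 'I_e, (i < j)%N -> u w (v i) (y i)].
  have [v hv] := main e (leqnn e); exists v; apply: sub_infinite_set hv => x [Xx [y [Gy hy]]]; split=> //.
  by exists y; split=> // i; apply: hy.
have hu' := dfn_u hu.
elim: j => [_|j IH je].
  have [x Xx] := infinite_setN0 infX; have [_ [v _]] := hGX _ Xx.
  exists v; apply: sub_infinite_set infX => z Xz; split=> //.
  by have [_ [y Gy]] := hGX _ Xz; exists y.
have [v infv] := IH (ltnW je).
pose i0 := Ordinal je.
pose H x (y : power M e) := G x y /\ forall i : 'I_e, (i < j)%N -> u w (v i) (y i).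
have hH : dfn2 setT H.
  rewrite /H; dfn_tac.
have updv t x (y : power M e) : H x y -> u w t (y i0) ->
    G x y /\ forall i : 'I_e, (i < j.+1)%N -> u w (upd v i0 t i) (y i).
  move=> [Gy hy] ht; split=> // i; rewrite ltnS leq_eqVlt /upd => /predU1P[ij|ij].
    by have -> : i = i0 by [apply: val_inj]; rewrite eqxx.
  have -> : (i == i0) = false by apply/negP => /eqP ii0; rewrite ii0 /= ltnn in ij.
  exact: hy.
pose Y : set Mh := [set t | exists x, X x /\ exists y, H x y /\ y i0 = t].
have hY : dfn setT Y by rewrite /Y /mkset; dfn_tac.
have [finY|infY] := pselect (finite_set Y).
  have [t ht] : exists t, infinite_set [set x | X x /\ exists y, H x y /\ y i0 = t].
    apply: contrapT => /forallNP fin; apply: infv.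
    apply: (@sub_finite_set _ _ (\bigcup_(t in Y) [set x | X x /\ exists y, H x y /\ y i0 = t])).
      by move=> x [Xx [y hy]]; exists (y i0); [exists x; split|split]=> //; exists y.
    by apply: bigcup_finite => // t _; apply: contrapT; exact: fin.
  exists (upd v i0 t); apply: sub_infinite_set ht => x [Xx [y [hy <-]]]; split=> //.
  by exists y; apply: updv => //; apply: (u_refl hu).
have [t [c [hc ht]]] := infinite_interior1 hu hY infY.
have [c' hc' hcc] := u_dir hu hc hw.
exists (upd v i0 t) => fin; apply: (infinite_ball hu (x := t) hc').
apply: (@sub_finite_set _ _ (\bigcup_(x in [set x | X x /\ exists y, G x y /\
    forall i : 'I_e, (i < j.+1)%N -> u w (upd v i0 t i) (y i)]) ((fun y => y i0) @` G x))).
  move=> s /= /hcc[/ht[x [Xx [y [hy ys]]]] ws].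
  have hy' := updv t x y hy; rewrite ys in hy'.
  by exists x; [split=> //; exists y; apply: hy'|exists y => //; case: hy].
by apply: bigcup_finite => // x [/hGX[? _] _]; apply: finite_image.
Qed.

(** Unlike an exact size, a bound by the range of a function on ['I_m] passes to subsets of the
    fibers. *)
Lemma card_range (I : Type) (A : set I) m : A #= `I_m -> exists f : 'I_m -> I, A `<=` range f.
Proof.
elim: m A => [|m IH] A.
  rewrite II0 card_eq0 => /eqP ->.
  by have f : 'I_0 -> I by [case]; exists f.
move=> /eq_cardSP[x Ax /IH[f hf]]; exists (fun i => oapp f x (unlift ord0 i)) => y Ay.
have [->|yx] := pselect (y = x); first by exists ord0; rewrite ?unlift_none.
by have [//|i _ <-] := hf y; exists (lift ord0 i); rewrite ?liftK.
Qed.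

(** If only finitely many fibers over the ball are nonempty, all are empty on a smaller ball.
    Otherwise every fiber over some smaller ball has a value near a fixed [v]. Values near [v] are
    matched with one another; deleting them lowers the bound, and induction handles the rest. *)
Lemma near_fibers1 m e (G : Mh -> set (power M e)) w a0 c0 :
  dfn2 setT G -> D w -> D c0 ->
  (forall x, u c0 a0 x -> exists f : 'I_m -> power M e, G x `<=` range f) ->
  exists a c, [/\ D c, forall z, u c a z -> u c0 a0 z &
    forall x x', u c a x -> u c a x' -> near_fib w (G x) (G x')].
Proof.
have hu' := dfn_u hu; have hn := dfn_near hu e.
have empty (G' : Mh -> set (power M e)) x x' c : (forall y, ~ G' x y) -> (forall y, ~ G' x' y) ->
    near_fib c (G' x) (G' x').
  by move=> h h'; split=> y; [move/h|move/h'].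
move=> + hw; elim: m G a0 c0 => [|m IH] G a0 c0 hG hc0 hf.
  exists a0, c0; split=> // x x' /hf[f hx] /hf[f' hx'].
  by apply: empty => y; [move/hx|move/hx'] => -[[]].
pose X : set Mh := [set x | u c0 a0 x /\ exists y, G x y].
have hX : dfn setT X by rewrite /X /mkset; dfn_tac.
have [finX|infX] := pselect (finite_set X).
  have infX' : infinite_set [set x | u c0 a0 x /\ ~ exists y, G x y].
    move=> fin; apply: (infinite_ball hu (x := a0) hc0).
    apply: (@sub_finite_set _ _ (X `|` [set x | u c0 a0 x /\ ~ exists y, G x y])).
      by move=> x hx; have [h|h] := pselect (exists y, G x y); [left|right].
    by rewrite finite_setU.
  have [|a [c [hc ha]]] := infinite_interior1 hu _ infX'; first by rewrite /mkset; dfn_tac.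
  exists a, c; split=> // [z /ha[]//|x x' /ha[_ h] /ha[_ h']].
  by apply: empty => y hy; [apply: h|apply: h']; exists y.
have [w1 hw1 [_ hw1w]] := near_half hw.
have [|v infv] := infinite_near_point hG hX hw1 infX.
  move=> x [hx ne]; split=> //; have [f Gf] := hf x hx.
  by apply: sub_finite_set Gf _; apply: finite_image.
pose N x (y : power M e) := G x y /\ near w1 v y.
have [|a1 [c1 [hc1 ha1]]] := infinite_interior1 hu _ infv; first by rewrite /mkset; dfn_tac.
pose G' x : set (power M e) := [set y | G x y /\ ~ near w1 v y].
have hG' : dfn2 setT G' by rewrite /G' /mkset; dfn_tac.
have [x|a [c [hc aa1 hG'c]]] := IH G' a1 c1 hG' hc1.
  move=> /ha1[[/hf[f Gf] _] [y [Gy vy]]].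
  have [i _ fi] := Gf _ Gy.
  exists (fun j => f (lift i j)) => z [/Gf[k _ <-] nk].
  case: (unliftP i k) nk => [j -> _|-> []]; first by exists j.
  by rewrite fi.
exists a, c; split=> // [z /aa1/ha1[[]]//|x x' hx hx'].
have [hxx' hx'x] := hG'c _ _ hx hx'.
have [_ [y0 [Gy0 vy0]]] := ha1 _ (aa1 _ hx).
have [_ [y0' [Gy0' vy0']]] := ha1 _ (aa1 _ hx').
split=> y Gy.
  have [vy|nvy] := pselect (near w1 v y).
    by exists y0' => //; apply: hw1w vy0'; apply: near_sym.
  by have [y' []] := hxx' y (conj Gy nvy); exists y'.
have [vy|nvy] := pselect (near w1 v y).
  by exists y0 => //; apply: hw1w vy; apply: near_sym.
by have [y' []] := hx'x y (conj Gy nvy); exists y'.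
Qed.

(** Induction and [uniform_ball] give one ball [b] over which, for all [x] in a ball of [M], the
    slice at [x] is nearly constant. [near_fibers1] treats the slice through the center of [b]. Then
    [(x, y)] and [(x', y')] are compared through [(x, b.1)] and [(x', b.1)]. *)
Lemma near_fibers d m e (G : power M d -> set (power M e)) w b0 :
  dfn2 setT G -> D w -> D b0.2 ->
  (forall x, near b0.2 b0.1 x -> exists f : 'I_m -> power M e, G x `<=` range f) ->
  exists b, [/\ D b.2, subball b b0 &
    forall x x', near b.2 b.1 x -> near b.2 b.1 x' -> near_fib w (G x) (G x')].
Proof.
elim: d G w b0 => [|d IH] G w [x0 c0] hG hw hc0 hf.
  exists (x0, c0); split=> // x x' _ _; have -> : x = x'.
    by apply: functional_extensionality_dep => -[].
  exact: near_fib_refl.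
(* Three comparisons will be chained, so [w] is halved twice. *)
have [w2 hw2 [_ hw2w]] := near_half hw; have [w1 hw1 [hw1u hw1w]] := near_half hw2.
have hu' := dfn_u hu.
pose K x (y z : power M d) := u c0 (x0 ord0) x /\
  near_fib w1 (G (pcons x y)) (G (pcons x z)).
have hK : dfn3 setT K.
  rewrite /K; dfn_tac; apply: dfn_near_fib => //; dfn_tac.
have inb x (b : power M d * env M zs) y : u c0 (x0 ord0) x -> subball b (ptail x0, c0) ->
    near b.2 b.1 y -> near c0 x0 (pcons x y).
  move=> hx sb /sb hy; rewrite (pconsE x0); apply/near_pcons; rewrite pcons0; split=> // i.
  by rewrite /ptail pconsS; apply: hy.
have [|x hx b hb sb|b [hb sb [a1 [c1 [hc1 ha1]]]]] :=
    @uniform_ball d K [set x | u c0 (x0 ord0) x] (ptail x0, c0) hK hc0.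
- exact: (infinite_ball hu).
- have [||b' [hb' sb' hb'G]] := IH (fun y => G (pcons x y)) w1 b _ hw1 hb.
  + by dfn_tac.
  + by move=> y hy; apply: hf; apply: inb sb hy.
  by exists b'; split=> // y z hy hz; split=> //; apply: hb'G.
have bb : near b.2 b.1 b.1 by apply: near_refl.
have [||a [c [hc aa1 hGc]]] := @near_fibers1 m e (fun x => G (pcons x b.1)) w1 a1 c1 _ hw1 hc1.
- by dfn_tac.
- by move=> x /ha1/(_ _ _ bb bb)[hx _]; apply: hf; apply: inb sb bb.
have [c' hc' hcc] := u_dir hu hc hb.
have inab v : near c' (pcons a b.1) v -> u c a (v ord0) /\ near b.2 b.1 (ptail v).
  move=> /near_pcons[h0 h]; split; first by case: (hcc _ _ h0).
  by move=> i; case: (hcc _ _ (h i)).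
exists (pcons a b.1, c'); split=> // [v /inab[/aa1/ha1 h hv]|v v' /inab[hv hbv] /inab[hv' hbv']].
  by rewrite (pconsE v); apply: inb sb hv; case: (h _ _ bb bb).
have [_ h1] := ha1 _ (aa1 _ hv) _ _ hbv bb.
have [_ h2] := ha1 _ (aa1 _ hv') _ _ bb hbv'.
rewrite (pconsE v) (pconsE v').
have h12 := near_fib_trans (hw1w e) h1 (hGc _ _ hv hv').
apply: near_fib_trans (hw2w e) h12 _.
by apply: near_fib_trans (hw1w e) h2 _; apply: near_fib_refl.
Qed.

(** * Generic points *)

Section Generic.
Variables (C : set (elt M)) (huC : tame_uniformity C).

(* No coordinate of [b] is algebraic over [C], [q] and the other coordinates. *)
Definition independent (Q : space M) (q : Q) d (b : power M d) : Prop :=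
  forall F : Q -> power M d -> Prop, dfn2 C F -> F q b ->
  forall i, infinite_set [set t | F q (upd b i t)].

(** The parameter [q] lives in an arbitrary space, so that coordinates of [b] can be moved into
    it. *)
Definition generic (Q : space M) (q : Q) d (b : power M d) : Prop :=
  forall E : Q -> set (power M d), dfn2 C E -> E q b -> large (E q).

(** Otherwise [b] lies in the definable set of noninterior points of [E q], which is not large. *)
Lemma generic_interior (Q : space M) (q : Q) d (b : power M d) (E : Q -> set (power M d)) :
  generic q b -> dfn2 C E -> E q b -> interior (E q) b.
Proof.
move=> gb hE Eb; apply: contrapT => nb.
have hI : dfn2 C (fun q x => E q x /\ ~ interior (E q) x).
  have hI := dfn_interior huC hE; by dfn_tac.
have [x [c [hc hx]]] := gb _ hI (conj Eb nb).
have [_ []] := hx x (near_refl x hc).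
by exists c; split=> // y /hx[].
Qed.

(** The first coordinate [t] moves to the parameters, and the others stay independent over [(q, t)].
    By induction [t] is interior to the sections over a large set of [x]; the Baire property makes
    the radius uniform. *)
Lemma independent_generic d (Q : space M) (q : Q) (b : power M d) :
  independent q b -> generic q b.
Proof.
have hDC := dfn_D huC; have huC' := dfn_u huC.
have hDT := dfn_D hu; have huT := dfn_u hu.
elim: d Q q b => [|d IH] Q q b ind E hE Eb; first by apply: large_power0; exists b.
move: (b ord0) (ptail b) (pconsE b) => t b' bE; subst b.
pose J (q : Q) s (x : power M d) := interior1 [set s' | E q (pcons s' x)] s.
have hJ : dfn3 C J by rewrite /J /interior1 /mkset; dfn_tac.
have hET : dfn2 setT E by apply: dfn_sub hE.
have hJT : dfn3 setT J by apply: dfn_sub hJ.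
(* Otherwise independence gives infinitely many points of the section over [b'] that are not
   interior to it, and such points cannot fill a ball. *)
have Jb : J q t b'.
  apply: contrapT => nJ.
  have hF : dfn2 C (fun q (x : power M d.+1) => E q x /\ ~ J q (x ord0) (ptail x)) by dfn_tac.
  have Fb : E q (pcons t b') /\ ~ J q (pcons t b' ord0) (ptail (pcons t b')).
    by rewrite pcons0 ptail_pcons.
  have := ind _ hF Fb ord0.
  have -> : [set s | E q (upd (pcons t b') ord0 s) /\
      ~ J q (upd (pcons t b') ord0 s ord0) (ptail (upd (pcons t b') ord0 s))] =
      [set s | E q (pcons s b') /\ ~ J q s b'].
    by apply/seteqP; split=> s; rewrite /= upd_pcons0 pcons0 ptail_pcons.
  move=> inf; have [|s [c [hc hs]]] := infinite_interior1 hu _ inf.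
    by rewrite /mkset; dfn_tac.
  have [_ []] := hs s (u_refl hu s hc).
  by exists c; split=> // y /hs[].
have ind' : independent (Q := prod_space Q (sort_space M (home L))) (q, t) b'.
  move=> F hF Fb i.
  have hF' : dfn2 C (fun q (x : power M d.+1) => F (q, x ord0) (ptail x)) by dfn_tac.
  have Fb' : F (q, pcons t b' ord0) (ptail (pcons t b')) by rewrite pcons0 ptail_pcons.
  apply: sub_infinite_set (ind _ hF' Fb' (lift ord0 i)) => s.
  by rewrite /= upd_pconsS pcons0 ptail_pcons.
pose E1 (p : Q * Mh) (x : power M d) := J p.1 p.2 x.
have hE1 : dfn2 C (E1 : prod_space Q (sort_space M (home L)) -> _) by rewrite /E1; dfn_tac.
have [x0 [c0 [hc0 hx0]]] := IH _ _ _ ind' E1 hE1 Jb.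
(* The large set given by induction is the increasing union of these sets over [c] in [D]. *)
pose Y c (x : power M d) := forall s, u c t s -> E q (pcons s x).
have hY : dfn2 setT Y by rewrite /Y; dfn_tac.
have hX : dfn setT (fun _ : power M d => False) by dfn_tac.
have mono c c' : D c -> D c' -> (forall x y, u c' x y -> u c x y) -> Y c `<=` Y c'.
  by move=> _ _ hcc x hx s /hcc/hx.
have [y /hx0[c [hc hy]]|[x [c [hc hx]]]|[c hc [x [c1 [hc1 hx]]]]] :=
  @directed_baire_all d _ _ hX hY mono x0 c0 hc0.
- by right; exists c.
- by case: (hx x (near_refl x hc)).
have [c2 hc2 hcc] := u_dir hu hc hc1.
exists (pcons t x), c2; split=> // v /near_pcons[h0 h].
rewrite (pconsE v); apply: hx; last by case: (hcc _ _ h0).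
by move=> i; case: (hcc _ _ (h i)).
Qed.

(* The discontinuity set is the increasing union over the scales w of the sets
   of w-discontinuity, which have empty interior by [near_fibers]. *)
Lemma generic_continuous d m e (G : power M d -> set (power M e)) (E : set (power M d))
    (b : power M d) (q0 : power M 0) :
  dfn2 C G -> dfn C E -> generic q0 b -> E b ->
  (forall x, E x -> exists f : 'I_m -> power M e, G x `<=` range f) ->
  forall w, D w -> exists2 c, D c &
    forall x, E x -> near c b x -> near_fib w (G b) (G x).
Proof.
move=> hG hE gb Eb hf.
have hDC := dfn_D huC; have huC' := dfn_u huC.
have hDT := dfn_D hu; have huT := dfn_u hu.
have hn := dfn_near huC d; have hnT := dfn_near hu d; have hne := dfn_near huC e.
pose cont w x := exists2 c, D c & forall x', E x' -> near c x x' -> near_fib w (G x) (G x').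
have hcont : dfn2 C cont.
  by rewrite /cont /near_fib; dfn_tac.
have hcontT : dfn2 setT cont by apply: dfn_sub hcont.
have hET : dfn setT E by apply: dfn_sub hE.
have hGT : dfn2 setT G by apply: dfn_sub hG.
apply: contrapT => nb.
pose N x := E x /\ ~ forall w, D w -> cont w x.
have hN : dfn2 C (fun (_ : power M 0) => N) by rewrite /N; dfn_tac.
have hNT : dfn setT N by rewrite /N; dfn_tac.
have [x0 [c0 [hc0 hx0]]] := gb _ hN (conj Eb nb).
pose Y w x := E x /\ ~ cont w x.
have hY : dfn2 setT Y by rewrite /Y; dfn_tac.
have hX : dfn setT (fun _ : power M d => False) by dfn_tac.
have mono w w' : D w -> D w' -> (forall x y, u w' x y -> u w x y) -> Y w `<=` Y w'.
  move=> _ _ hww x [Ex ncw]; split=> // -[c hc h]; apply: ncw; exists c => // x' Ex' xx'.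
  have [h1 h2] := h x' Ex' xx'.
  split=> y; first by move=> /h1[y' ? yy']; exists y' => // i; apply: hww.
  by move=> /h2[y' ? yy']; exists y' => // i; apply: hww.
have [y /hx0[Ey /existsNP[w /not_implyP[hw nc]]]|[x [c [hc hx]]]|[w hw [x [c [hc hx]]]]] :=
  @directed_baire_all d _ _ hX hY mono x0 c0 hc0.
- by right; exists w.
- by case: (hx x (near_refl x hc)).
(* Here a ball consists of points of [w]-discontinuity, yet [near_fibers] finds a smaller ball over
   which all fibers are [w]-near. *)
have h0 y : near c x y -> exists f : 'I_m -> power M e, G y `<=` range f.
  by move=> Yy; apply: hf; case: (hx _ Yy).
have [[x1 c1] [hc1 sb hG1]] := near_fibers (b0 := (x, c)) hGT hw hc h0.
have b1 := near_refl x1 hc1.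
have [_ []] := hx x1 (sb x1 b1).
by exists c1 => // x' _ hx'; apply: hG1.
Qed.

End Generic.

End Uniformity.

(** * Indexing the definable uniformity *)

(** Balls are infinite because a finite ball around [x] would make [x] isolated: separation excludes
    each of its other points, and a common refinement leaves only [x]. *)
Lemma definable_uniformity_tame (L : language) (M : structure L) (C : set (elt M))
    (B : set (set (M (home L) * M (home L)))) :
  definable_uniformity C B -> no_isolated_points B ->
  infinite_definable_has_interior B -> infinite_set [set: M (home L)] ->
  exists (n : nat) (zs : 'I_n -> sort L) (D : set (env M zs))
    (u : env M zs -> M (home L) -> M (home L) -> Prop),
    tame_uniformity D u C /\
    B = [set U | exists2 c, D c & U = [set p | u c p.1 p.2]].
Proof.
move=> [[n [zs [phi [D [[psi hpsi] BE]]]]] hdiag hsym hdir hhalf] hisol hint hinf.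
pose u (c : env M zs) x y := sat phi (ext_env x (ext_env y c)).
exists n, zs, D, u; split=> //.
have BD c : D c -> B [set p | u c p.1 p.2] by rewrite BE; exists c.
have DB U : B U -> exists2 c, D c & forall x y, U (x, y) <-> u c x y.
  by rewrite BE => -[c hc ->]; exists c.
have hD : dfn C D by exists psi => s; rewrite hpsi.
have hu : dfn3 C u.
  pose S := prod_space (env_space M zs)
    (prod_space (sort_space M (home L)) (sort_space M (home L))).
  pose ctx := sum_ctx (@ssort L M S) (@param_ctx L M C).
  have [|chi hchi] := @subst_ex L M _ _ phi _ ctx S
      (fun s => ext_env s.2.1 (ext_env s.2.2 s.1))
      (fun s => sum_env (enc s) (@param_env L M C)).
    case=> [[i|]|].
    - by exists (TVar ctx (inl (inl i))).
    - by exists (TVar ctx (inl (inr (inr tt)))).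
    - by exists (TVar ctx (inl (inr (inl tt)))).
  by exists chi => s; exact: iff_sym (hchi s).
have dir c c' : D c -> D c' ->
    exists2 c'', D c'' & forall x y, u c'' x y -> u c x y /\ u c' x y.
  move=> /BD hc /BD hc'; have [W /DB[c'' hc'' hW] WU] := hdir _ _ hc hc'.
  by exists c'' => // x y /hW/WU.
have refl c x : D c -> u c x x.
  move=> hc; have : diagonal (x, x) by [].
  by rewrite -hdiag => /(_ _ (BD c hc)).
have sep x y : x <> y -> exists2 c, D c & ~ u c x y.
  move=> xy; apply: contrapT => h; apply: xy.
  suff : diagonal (x, y) by [].
  rewrite -hdiag => U /DB[c hc /(_ x y) hU]; apply/hU.
  by apply: contrapT => nu; apply: h; exists c.
(* An empty family has the whole square as intersection, and if that is the diagonal then [M] has at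
   most one point. *)
have Dne : exists c, D c.
  apply: contrapT => nD; apply: hinf.
  have eq (x y : M (home L)) : x = y.
    apply: contrapT => xy; have [c hc _] := sep _ _ xy.
    by apply: nD; exists c.
  have [[x]|nx] := pselect (exists x : M (home L), True).
    by move=> _; apply: (@sub_finite_set _ _ [set x]) => // y _; exact: eq.
  by apply: (@sub_finite_set _ _ set0) => // y _; case: nx; exists y.
split=> //.
- move=> c x y hc; exact: (hsym _ (BD c hc)).
- move=> c hc; have [V /DB[c' hc' hV] VU] := hhalf _ (BD c hc).
  exists c' => // x y z /hV xy /hV yz.
  by apply: (VU (x, z)); exists y.
- move=> X hX infX.
  have [|O [hO [x Ox] OX]] := hint X _ infX.
    have [chi hchi] : dfn setT (fun a : power M 1 => X (a ord0)).
      by apply: (dfn_comp hX); dmap_tac.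
    by exists chi; apply/seteqP; split=> a /hchi.
  have [U /DB[c hc hU] UO] := hO x Ox.
  by exists x, c; split=> // y hy; apply/OX/UO/hU.
- move=> c x hc /finite_set_ord[k [g [_ hg]]]; apply: (hisol x) => _ ->.
  have [c' hc' gc'] : exists2 c', D c' & forall i, g i <> x -> ~ u c' x (g i).
    elim: k g {hg} => [|k IH] g; first by have [c0 hc0] := Dne; exists c0 => // -[].
    have [c1 hc1 h1] := IH (fun i => g (lift ord0 i)).
    have [gx|gx] := pselect (g ord0 = x).
      by exists c1 => // i; case: (unliftP ord0 i) => [j|] -> // /h1.
    have [c2 hc2 h2] := sep _ _ (nesym gx).
    have [c3 hc3 h3] := dir _ _ hc1 hc2; exists c3 => // i.
    by case: (unliftP ord0 i) => [j|] -> => [/h1 n1 /h3[]|_ /h3[_]].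
  have [c'' hc'' hcc] := dir _ _ hc hc'.
  exists [set p | u c'' p.1 p.2]; first exact: BD.
  move=> y /= /hcc[xy xy']; have [i _ gi] := hg y xy; subst y.
  by apply: contrapT => /gc'.
Qed.

(** * Decomposition into graphs *)

(** The list enumerates [I] and then its complement, so that [split_power] separates the coordinates
    in [I] from the others. *)
Lemma perm_to_front (k : nat) (I : {set 'I_k}) (hd : (#|I| <= k)%N) :
  exists s : 'S_k, (forall i, s (cast_ord (subnKC hd) (lshift (k - #|I|) i)) \in I) /\
    forall j, j \in I -> exists i, s (cast_ord (subnKC hd) (lshift (k - #|I|) i)) = j.
Proof.
pose l := enum I ++ enum (~: I).
have sl : size l = k by rewrite size_cat -!cardE cardsC card_ord.
have ul : uniq l.
  rewrite cat_uniq !enum_uniq /= andbT -all_predC; apply/allP => x.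
  by rewrite /= !mem_enum inE.
pose f (i : 'I_k) : 'I_k := tnth (in_tuple l) (cast_ord (esym sl) i).
have finj : injective f.
  have /tuple_uniqP tu : uniq (in_tuple l) by [].
  move=> i j fij; exact: cast_ord_inj (tu _ _ fij).
have fE (i : 'I_#|I|) : f (cast_ord (subnKC hd) (lshift (k - #|I|) i)) = enum_val i.
  rewrite /f (tnth_nth (enum_val i)) /= nth_cat -cardE ltn_ord.
  exact/esym/enum_val_nth.
exists (perm finj); split=> [i|j jI]; first by rewrite permE fE enum_valP.
by exists (enum_rank_in jI j); rewrite permE fE enum_rankK_in.
Qed.

Lemma definable_dfn (L : language) (M : structure L) (C : set (elt M)) k (X : set (power M k)) :
  definable_power C X <-> dfn C X.
Proof.
split=> [[phi ->]|[phi h]]; first by exists phi.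
by exists phi; apply/seteqP; split=> x /h.
Qed.

Lemma definable_prod_dfn (L : language) (M : structure L) (C : set (elt M)) d e
    (G : set (power M d * power M e)) : dfn C G -> definable_prod C G.
Proof.
move=> [phi h].
pose ctx := sum_ctx (@home_ctx L ('I_d + 'I_e)) (@param_ctx L M C).
have [|psi hpsi] := @subst_ex L M _ _ phi _ ctx (env M (@home_ctx L ('I_d + 'I_e)))
  (fun v => sum_env (enc ((fun i => v (inl i) : M (home L)) : power M d,
                          (fun j => v (inr j) : M (home L)) : power M e))
                    (@param_env L M C))
  (fun v => sum_env v (@param_env L M C)).
  case=> [[i|j]|c].
  - by exists (TVar ctx (inl (inl i))).
  - by exists (TVar ctx (inl (inr j))).
  - by exists (TVar ctx (inr c)).
by exists psi; apply/seteqP; split=> v; [move/h/hpsi|move/hpsi/h].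
Qed.

Section Decomposition.
Variables (L : language) (T : set (sentence L)) (M : structure L).
Hypotheses (hsat : saturated M) (hNIP : NIP_theory T) (hMT : models M T).
Variables (n : nat) (zs : 'I_n -> sort L) (D : set (env M zs))
  (u : env M zs -> M (home L) -> M (home L) -> Prop) (C : set (elt M)).
Hypothesis hu : tame_uniformity D u C.

Let B : set (set (M (home L) * M (home L))) :=
  [set U | exists2 c, D c & U = [set p | u c p.1 p.2]].

Lemma tame_uniformityT : tame_uniformity D u setT.
Proof.
case: hu => hD hu' *; split=> //.
  exact: dfn_sub (@subsetT _ C) hD.
exact: dfn_sub (@subsetT _ C) hu'.
Qed.

Lemma interior_open k (O : set (power M k)) :
  (forall x, O x -> interior D u O x) -> open_power B O.
Proof.
move=> hO x /hO[c [hc cO]].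
(* Balls need not be open, so the factors are their interiors. *)
exists (fun i => interior1 D u [set y | u c (x i) y]); split=> [i y [c1 [hc1 h1]]|i|y hy].
- have [c2 hc2 h2] := u_half hu hc1.
  exists [set p | u c2 p.1 p.2]; first by exists c2.
  move=> z yz; exists c2; split=> // w zw; apply: h1; exact: h2 yz zw.
- by exists c; split.
- by apply: cO => i; have [c1 [hc1]] := hy i; apply; apply: (u_refl hu).
Qed.

Lemma interiorS k (X : set (power M k)) x : interior D u X x -> X x.
Proof. by move=> [c [hc h]]; apply: h; apply: (near_refl tame_uniformityT). Qed.

Lemma interior_idem k (X : set (power M k)) x :
  interior D u X x -> interior D u (interior D u X) x.
Proof.
move=> [c [hc h]]; have [c' hc' [_ h']] := near_half tame_uniformityT hc.
exists c'; split=> // y xy; exists c'; split=> // z yz; apply: h; exact: h' xy yz.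
Qed.

Lemma continuous_graph_at k (A : set (power M k)) (a : power M k) :
  dfn C A -> A a -> exists X, [/\ dfn C X, X a, X `<=` A & continuous_graph B C X].
Proof.
move=> hA Aa.
pose agree (I : {set 'I_k}) (x : power M k) := forall i, i \in I -> x i = a i.
(* This says that [a] is algebraic over [C] and its coordinates in [I]; the witness [F] is a
   [C]-definable condition on all coordinates. *)
pose alg (I : {set 'I_k}) := exists F : set (power M k),
  [/\ dfn C F, F a & finite_set [set x | F x /\ agree I x]].
have algT : alg [set: 'I_k]%SET.
  exists (fun=> True); split=> //; first exact: dfn_const.
  apply: (@sub_finite_set _ _ [set a]) => // x [_ hx].
  by apply: functional_extensionality_dep => i; apply: hx.
have [I algI minI] : exists2 I, alg I & forall I', alg I' -> (#|I| <= #|I'|)%N.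
  have ex : exists m, `[< exists I, alg I /\ #|I| = m >].
    by exists #|[set: 'I_k]%SET|; apply/asboolP; exists [set: 'I_k]%SET.
  case: (ex_minnP ex) => m /asboolP[I [aI mI]] hm.
  by exists I => // I' aI'; rewrite mI; apply: hm; apply/asboolP; exists I'.
have hd : (#|I| <= k)%N by rewrite -[X in (_ <= X)%N](card_ord k) max_card.
have [s [sI Is]] := perm_to_front hd.
have [F0 [hF0 F0a finF0]] := algI.
pose d := #|I|; pose e := (k - d)%N.
pose pr (z : power M k) := split_power hd (fun i => z (s i)).
pose join (x : power M d) (y : power M e) : power M k := fun j =>
  match fintype.split (cast_ord (esym (subnKC hd)) ((s^-1)%g j)) with
  | inl i => x i | inr i => y i end.
have joinl x y i : join x y (s (cast_ord (subnKC hd) (lshift e i))) = x i.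
  by rewrite /join permK cast_ordK (fintype.unsplitK (inl i)).
have joinr x y i : join x y (s (cast_ord (subnKC hd) (rshift d i))) = y i.
  by rewrite /join permK cast_ordK (fintype.unsplitK (inr i)).
have prK z : join (pr z).1 (pr z).2 = z.
  apply: functional_extensionality_dep => j.
  rewrite -(permKV s j); move: ((s^-1)%g j) => {}j.
  rewrite -(cast_ordKV (subnKC hd) j); move: (cast_ord _ j) => {}j.
  by rewrite -(fintype.splitK j); case: (fintype.split j) => i /=; rewrite ?joinl ?joinr.
have joinK x y : pr (join x y) = (x, y).
  by congr (_, _); apply: functional_extensionality_dep => i; rewrite /= ?joinl ?joinr.
have dpr1 : dmap C (fun z => (pr z).1).
  apply: dmap_tuple => i.
  exact: (dmap_coord (s (cast_ord (subnKC hd) (lshift e i))) (@dmap_id _ _ C _)).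
have dpr2 : dmap C (fun z => (pr z).2).
  apply: dmap_tuple => i.
  exact: (dmap_coord (s (cast_ord (subnKC hd) (rshift d i))) (@dmap_id _ _ C _)).
(* Intersecting the witness of algebraicity with [A] keeps the graph inside [A]. *)
pose F x y := F0 (join x y) /\ A (join x y).
have hF : dfn2 C F.
  have hj : dmap C (fun p : power M d * power M e => join p.1 p.2).
    apply: dmap_tuple => j; rewrite /join.
    by case: (fintype.split _) => i; dmap_tac.
  by apply: dfn_and; apply: (dfn_comp _ hj).
pose b := (pr a).1.
have joinb : join b (pr a).2 = a by exact: prK.
have finb : finite_set [set y | F b y].
  apply: sub_finite_set (finite_image (fun z => (pr z).2) finF0) => y [Fy _].
  exists (join b y); rewrite ?joinK //; split=> // j jI.
  by have [i <-] := Is j jI; rewrite joinl.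
have [m hm] := finb.
(* The number [m] of values over [b] is imposed on all of [E], which yields an
   [m]-correspondence. *)
pose E x := [set y | F x y] #= `I_m /\ exists y, F x y.
have hE : dfn C E by apply: dfn_and; [exact: dfn_card|dfn_tac].
have Eb : E b by split=> //; exists (pr a).2; rewrite /F joinb.
(* The only point of [M^0] serves as a dummy parameter. *)
pose q0 : power M 0 := fun i => a (widen_ord (leq0n k) i).
have dq (Q : space M) : dmap C (fun _ : Q => q0) by apply: dmap_tuple => -[].
have ind : independent C q0 b.
  move=> F1 hF1 F1b i fin.
  pose t0 := s (cast_ord (subnKC hd) (lshift e i)).
  (* If [F1] left finitely many choices for coordinate [i], the points of the witness below that
     agree with [a] on [I :\ t0] would have finitely many projections to [M^d], each with finitely
     many values because of [E]. This contradicts the minimality of [I]. *)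
  have : (#|I :\ t0| < #|I|)%N by rewrite [X in (_ < X)%N](cardsD1 t0) sI.
  rewrite ltnNge => /negP; apply; apply: minI.
  exists (fun z => [/\ E (pr z).1, F (pr z).1 (pr z).2 & F1 q0 (pr z).1]); split.
  - suff : dfn C (fun z => E (pr z).1 /\ (F (pr z).1 (pr z).2 /\ F1 q0 (pr z).1)).
      by apply: dfn_ext => z; split=> [[? []]|[]].
    apply: dfn_and; first exact: (dfn_comp hE).
    by apply: dfn_and; [exact: (dfn_app2 hF)|exact: (dfn_app2 hF1)].
  - by split=> //; rewrite /F joinb.
  - pose G t := [set y | E (upd b i t) /\ F (upd b i t) y].
    apply: (@sub_finite_set _ _ (\bigcup_(t in [set t | F1 q0 (upd b i t)])
        ((fun y => join (upd b i t) y) @` G t))).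
      move=> z [[Ez Fz F1z] az].
      have bz : (pr z).1 = upd b i ((pr z).1 i).
        apply: functional_extensionality_dep => j; rewrite /upd.
        case: eqP => [->//|ji]; apply: az; rewrite !inE sI andbT.
        apply/eqP => /perm_inj/cast_ord_inj/lshift_inj; exact: ji.
      exists ((pr z).1 i); rewrite /G /= -bz //.
      by exists (pr z).2; rewrite ?prK.
    apply: bigcup_finite => // t _; apply: finite_image.
    have [Et|nEt] := pselect (E (upd b i t)).
      by apply: (@sub_finite_set _ _ [set y | F (upd b i t) y]) => [y []//|]; exists m; case: Et.
    by apply: (@sub_finite_set _ _ set0) => // y [].
have gen := independent_generic hsat hNIP hMT tame_uniformityT hu ind.
pose cont x := forall w, D w -> exists2 c, D c &
  forall x', E x' -> near u c x x' -> near_fib u w (F x) (F x').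
pose V x := E x /\ cont x.
have hV : dfn C V.
  have hn := dfn_near hu d; have hne := dfn_near hu e; have hD := dfn_D hu.
  by rewrite /V /cont /near_fib; dfn_tac.
have Vb : V b.
  split=> // w hw.
  apply: (generic_continuous hsat hNIP hMT tame_uniformityT hu hF hE gen Eb (m := m)) => // x [hx _].
  exact: card_range hx.
(* The set [V] need not be open; its interior is, and it contains the generic point [b]. *)
pose U x := interior D u V x.
have hU : dfn C U.
  have hV2 : dfn2 C (fun (_ : power M 0) => V) by dfn_tac.
  have hI := dfn_interior hu hV2.
  by apply: (dfn_comp (f := fun x => (q0 , x)) hI); apply: dmap_pair; [exact: dq|exact: dmap_id].
have Ub : U b.
  have hV2 : dfn2 C (fun (_ : power M 0) => V) by dfn_tac.
  exact: (generic_interior tame_uniformityT hu gen hV2 Vb).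
pose G : set (power M d * power M e) := [set p | U p.1 /\ F p.1 p.2].
have fibG x : U x -> fiber G x = [set y | F x y].
  by move=> Ux; apply/seteqP; split=> y /=; [case|split].
have hG : dfn C G by apply: dfn_and => //; dfn_tac.
exists [set z | G (pr z)]; split.
- apply: (dfn_comp (f := pr) hG); exact: dmap_pair.
- by split=> //; rewrite /F joinb.
- by move=> z [_ []]; rewrite prK.
exists d, hd, m, s, U, G; split=> //.
- by apply: interior_open => x; exact: interior_idem.
- split.
  + exact/definable_dfn.
  + by apply/definable_dfn; exact: dfn_const.
  + exact: definable_prod_dfn.
  + by move=> [x y] [].
  + move=> x Ux; rewrite fibG //; have [[Ex [y Fy]] _] := interiorS Ux.
    by split; [exists m|exists y].
- by move=> x Ux; rewrite fibG //; have [[]] := interiorS Ux.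
- move=> x Ux _ [w hw ->]; have [Ex cx] := interiorS Ux.
  have [c hc h] := cx w hw; exists [set p | u c p.1 p.2]; first by exists c.
  by move=> x' Ux' xx'; rewrite !fibG //; apply: h => //; have [] := interiorS Ux'.
Qed.

End Decomposition.

(** * Finite covers by saturation *)

Theorem proposition4p1 (L : language) (T : set (sentence L)) (M : structure L)
  (hTcomplete : complete_theory T) (hTNIP : NIP_theory T)
  (hMT : models M T) (hMsat : saturated M) (hMdp : dp_minimal M)
  (C : set (elt M)) (hC : small C)
  (B : set (set (M (home L) * M (home L))))
  (hB : definable_uniformity C B)
  (hBisol : no_isolated_points B)
  (hBint : infinite_definable_has_interior B)
  (k : nat) (A : set (power M k)) (hA : definable_power C A) :
  exists (n : nat) (As : 'I_n -> set (power M k)),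
    (forall i, definable_power C (As i) /\ As i `<=` A) /\
    A `<=` \bigcup_(i in [set: 'I_n]) As i /\
    (forall i, continuous_graph B C (As i)).
Proof.
have hinf : infinite_set [set: M (home L)].
  have [[phi [S [hS _]]] _] := hMdp.
  by apply: sub_infinite_set (hS ord0).
have [n [zs [D [u [hu BE]]]]] := definable_uniformity_tame hB hBisol hBint hinf.
pose good X := [/\ dfn C X, X `<=` A & continuous_graph B C X].
have hA' : dfn C A by exact/definable_dfn.
have ptwise a : A a -> exists2 X, good X & X a.
  move=> Aa; have [X [h1 h2 h3 h4]] := continuous_graph_at hMsat hTNIP hMT hu hA' Aa.
  by exists X => //; split=> //; rewrite BE.
(* An empty [A] is covered by the empty family; a nonempty one supplies a graph [X0] as default
   value. *)
have [[a0 Aa0]|nA] := pselect (exists a, A a); last first.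
  exists 0%N, (fun=> set0); split=> [i|]; first by have := ltn_ord i.
  split=> [a Aa|i]; last by have := ltn_ord i.
  by case: nA; exists a.
have [X0 gX0 _] := ptwise a0 Aa0.
apply: contrapT => nocover.
(* Without a finite cover, the conditions of lying in [A], indexed by [None], and outside each good
   graph are finitely satisfiable. A common solution contradicts [ptwise]. *)
pose P (j : option {X | good X}) (a : power M k) : Prop :=
  if j is Some X then ~ sval X a else A a.
have [|m g|a ha] := @saturated_space L M hMsat C (power_space M k) _ P hC.
- by move=> [X|] //=; have [hX _ _] := svalP X; apply: dfn_not.
- apply: contrapT => nex; apply: nocover.
  pose As i := if g i is Some X then sval X else X0.
  have gAs i : good (As i) by rewrite /As; case: (g i) => [[X gX]|].
  exists m, As; split=> [i|]; first by have [/definable_dfn h1 h2 _] := gAs i.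
  split=> [a Aa|i]; last by have [] := gAs i.
  apply: contrapT => na; apply: nex; exists a => i; rewrite /P.
  by case gi : (g i) => [X|//] Xa; apply: na; exists i => //; rewrite /As gi.
- have [X gX Xa] := ptwise a (ha None).
  exact: (ha (Some (exist _ X gX))).
Qed.
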